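(* There exist universal constants $0<c\le C<\infty$ such that the following holds. Let $1\le d\le n$ be integers, let $X_1,\dots,X_n$ be i.i.d. $\mathsf N(0,I_d)$, and let the logistic model be well specified with $\theta^\star=0$, i.e. $Y_1,\dots,Y_n$ are i.i.d. uniform on $\{-1,1\}$ and independent of $X_{1:n}$. Then, for every $\delta\in(0,1/2]$, $$c\,\min\Big\{n,\ d+\log\frac1\delta\Big\}\le \mathsf Q_{1-\delta}\Big(\Lambda_n^{\log}(0;X_{1:n};Y_{1:n})\Big)\le C\,\min\Big\{n,\ d+\log\frac1\delta\Big\},$$ where the quantile is with respect to the joint randomness of the Gaussian design and the labels.
   Context: $\sigma(t)=1/(1+e^{-t})$, and $$\Lambda_n^{\log}(\theta^\star;X_{1:n};Y_{1:n})=\log\frac{\sup_{\theta\in\mathbb R^d}\prod_{i=1}^n\sigma(Y_i\langle X_i,\theta\rangle)}{\prod_{i=1}^n\sigma(Y_i\langle X_i,\theta^\star\rangle)},$$ so at $\theta^\star=0$ the denominator equals $2^{-n}$. For a real random variable $Z$, $\mathsf Q_{1-\delta}(Z)=\inf\{z\in\mathbb R:\mathbf P(Z\le z)\ge 1-\delta\}$. *)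

(* Defs.v *)
From HB Require Import structures.
From mathcomp Require Import all_boot all_order all_algebra.
From mathcomp Require Import all_classical all_reals all_analysis.

Set Implicit Arguments.
Unset Strict Implicit.
Unset Printing Implicit Defensive.

Import Order.TTheory GRing.Theory Num.Theory.

Local Open Scope classical_set_scope.
Local Open Scope ring_scope.

(* Covariates live in [d.-tuple R], whose library sigma-algebra (generated by
   the coordinates) is the Borel one of R^d; parameters live in ['rV[R]_d]. *)
Definition inner (R : realType) (d : nat) (x : d.-tuple R) (theta : 'rV[R]_d)
  : R := \sum_(j < d) tnth x j * theta ord0 j.

Definition sigmoid (R : realType) (t : R) : R := 1 / (1 + expR (- t)).

Definition likelihood (R : realType) (d n : nat)
    (X : n.-tuple (d.-tuple R)) (Y : n.-tuple R) (theta : 'rV[R]_d) : R :=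
  \prod_(i < n) sigmoid (tnth Y i * inner (tnth X i) theta).

(* The real-valued [sup] is the true supremum here: the likelihoods form a
   nonempty subset of [0, 1]. *)
Definition log_likelihood_ratio (R : realType) (d n : nat)
    (theta_star : 'rV[R]_d) (X : n.-tuple (d.-tuple R)) (Y : n.-tuple R) : R :=
  ln (sup (range (likelihood X Y)) / likelihood X Y theta_star).

(* For 0 < p < 1 and a random variable Z, the set below is nonempty and bounded
   from below, so that the real-valued [inf] is the true infimum. *)
Definition quantile (R : realType) (disp : measure_display)
    (T : measurableType disp) (P : probability T R) (p : R) (Z : T -> R) : R :=
  inf [set z : R | (p%:E <= P [set w | (Z w <= z)%R])%E].

Definition mutually_independent (R : realType) (disp dispE : measure_display)
    (T : measurableType disp) (E : measurableType dispE) (P : probability T R)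
    (n : nat) (X : 'I_n -> T -> E) : Prop :=
  forall (J : {set 'I_n}) (B : 'I_n -> set E),
    (forall i, measurable (B i)) ->
    P [set w | forall i, i \in J -> B i (X i w)]
      = (\prod_(i in J) P (X i @^-1` B i))%E.

Definition independent_pair (R : realType)
    (disp disp1 disp2 : measure_display) (T : measurableType disp)
    (E1 : measurableType disp1) (E2 : measurableType disp2)
    (P : probability T R) (U : T -> E1) (V : T -> E2) : Prop :=
  forall (A : set E1) (B : set E2), measurable A -> measurable B ->
    P ((U @^-1` A) `&` (V @^-1` B)) = (P (U @^-1` A) * P (V @^-1` B))%E.

(* Z ~ N(0, I_d): the coordinates of Z are independent and N(0, 1). *)
Definition standard_gaussian (R : realType) (disp : measure_display)
    (T : measurableType disp) (P : probability T R) (d : nat)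
    (Z : T -> d.-tuple R) : Prop :=
  mutually_independent P (fun (j : 'I_d) (w : T) => tnth (Z w) j) /\
  forall (j : 'I_d) (A : set R), measurable A ->
    P [set w | A (tnth (Z w) j)] = normal_prob 0 1 A.

Definition uniform_sign (R : realType) (disp : measure_display)
    (T : measurableType disp) (P : probability T R) (Z : T -> R) : Prop :=
  P [set w | Z w = 1] = (2^-1 : R)%:E /\ P [set w | Z w = - 1] = (2^-1 : R)%:E.

(* At parameter 0 the logistic model gives P(Y_i = 1 | X_i) = sigmoid 0 = 1/2. *)
Definition null_logistic_model (R : realType) (disp : measure_display)
    (T : measurableType disp) (P : probability T R) (d n : nat)
    (X : 'I_n -> {RV P >-> d.-tuple R}) (Y : 'I_n -> {RV P >-> R}) : Prop :=
  [/\ mutually_independent P (fun i : 'I_n => X i : T -> d.-tuple R),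
      forall i, standard_gaussian P (X i),
      mutually_independent P (fun i : 'I_n => Y i : T -> R),
      forall i, uniform_sign P (Y i)
    & independent_pair P (fun w => [tuple X i w | i < n])
                         (fun w => [tuple Y i w | i < n])].

(* Main.v *)
Require Import Defs.
From HB Require Import structures.
From mathcomp Require Import all_boot all_order all_algebra.
From mathcomp Require Import all_classical all_reals all_analysis.
From mathcomp Require Import measurable_realfun ring lra zify.

Set Implicit Arguments.
Unset Strict Implicit.
Unset Printing Implicit Defensive.

Import Order.TTheory GRing.Theory Num.Theory.
Import numFieldNormedType.Exports.

Local Open Scope classical_set_scope.
Local Open Scope ring_scope.

(** Put z_i = Y_i X_i and S = sum_i z_i.  The z_i are again i.i.d. N(0, I_d),
    and since sigmoid (t) = e^{t/2} / (2 cosh (t/2)), the likelihood ratio at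
    theta is exp (<S, theta>/2 - sum_i log cosh (<z_i, theta>/2)).

    Lower bound: log cosh x <= 2 x^2 and the operator norm bound
    sum_i <z_i, u>^2 <= K n |u|^2 give Lambda >= |S|^2 / (8 K n), by taking
    theta proportional to S.  With probability > 1/2, half of the coordinates
    of S are of order sqrt n, so that |S|^2 >= c n d; with probability
    > e^{-m}, the first one is of order sqrt (n m), for m = min (n, log 1/delta).

    Upper bound: always Lambda <= n, so one may assume d + log (1/delta) <= c n.
    As log cosh x >= min (|x|, x^2) / 16, it suffices that
    sum_i |<z_i, u>| >= c n for all unit vectors u; then Lambda <= C |S|^2 / n.
    This holds on a net because n / 2 given rows are simultaneously almost
    orthogonal to a fixed u with probability e^{-C n}, and it extends to the
    sphere by the operator norm bound.  All the other estimates are union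
    bounds over nets of tails of the forms sum_i b_i <z_i, u>, which are
    N(0, |b|^2 |u|^2). *)

(** * Nets of the Euclidean ball *)

(** The supremum runs over an unbounded set of theta. As log cosh is only linear at infinity, a
    lower bound on sum_i <z_i, u>^2 would not control large theta (for separable data the likelihood
    has no maximiser at all). This is why sums of absolute values are bounded from below, and why
    the upper bound also asks that |S| be small compared with n: the linear cost then beats the
    linear gain <S, theta>/2.

    The second constraint is the level of the exceptional sets. The regime before the cap n takes
    over reaches delta of order e^{-c n}, so every event about the design must fail with probability
    exponentially small in n and below delta; the rate e^{-4n} is used throughout. Bounds on moments
    of sum_i |<z_i, u>| would be too weak. Choosing the n / 2 bad rows costs only 2^n, and a small
    enough threshold [a] makes the probability per row e^{-10}, which pays for this choice and for
    the net. In the lower bound, the same rate keeps the operator norm event negligible against a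
    Gaussian tail of order e^{-m}. For the term d of the lower bound, constant probability suffices,
    because 1 - delta >= 1/2. *)

Section Euclidean.
Variables (R : realType) (k : nat).
Implicit Types x y u v : 'rV[R]_k.

Definition dot x y : R := \sum_j x ord0 j * y ord0 j.
Definition nrm x : R := Num.sqrt (dot x x).

Lemma dotC x y : dot x y = dot y x.
Proof. by apply: eq_bigr => j _; rewrite mulrC. Qed.

Lemma dotDr x y z : dot x (y + z) = dot x y + dot x z.
Proof. by rewrite -big_split; apply: eq_bigr => j _; rewrite /= mxE mulrDr. Qed.

Lemma dotZr a x y : dot x (a *: y) = a * dot x y.
Proof. by rewrite mulr_sumr; apply: eq_bigr => j _; rewrite mxE mulrCA. Qed.

Lemma dotDl x y z : dot (x + y) z = dot x z + dot y z.
Proof. by rewrite dotC dotDr !(dotC z). Qed.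

Lemma dotZl a x y : dot (a *: x) y = a * dot x y.
Proof. by rewrite dotC dotZr dotC. Qed.

Lemma dot_ge0 x : 0 <= dot x x.
Proof. by apply: sumr_ge0 => j _; rewrite -expr2 sqr_ge0. Qed.

Lemma dot_eq0 x : dot x x = 0 -> x = 0.
Proof.
move=> x0; apply/rowP => j; rewrite mxE; apply/eqP; rewrite -sqrf_eq0 expr2.
move/eqP: x0; rewrite psumr_eq0 => [|i _]; last by rewrite -expr2 sqr_ge0.
by move=> /allP/(_ j); rewrite mem_index_enum => /(_ isT)/=.
Qed.

Lemma dot0r x : dot x 0 = 0.
Proof. by rewrite -(scale0r x) dotZr mul0r. Qed.

Lemma nrm_ge0 x : 0 <= nrm x. Proof. exact: sqrtr_ge0. Qed.

Lemma sqr_nrm x : nrm x ^+ 2 = dot x x.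
Proof. by rewrite sqr_sqrtr ?dot_ge0. Qed.

Lemma dot_le_nrm x y : dot x y <= nrm x * nrm y.
Proof.
have [y0|y0] := eqVneq (dot y y) 0.
  by rewrite (dot_eq0 y0) dot0r mulr_ge0 ?nrm_ge0.
have yp : 0 < dot y y by rewrite lt_neqAle eq_sym y0 dot_ge0.
have := dot_ge0 (dot y y *: x + - dot x y *: y).
rewrite !(dotDl, dotDr, dotZl, dotZr) (dotC y x).
move: (dot y y) yp (dot x y) (dot x x) (dot_ge0 x) (sqr_nrm x) (sqr_nrm y)
  (nrm_ge0 x) (nrm_ge0 y) => q q0 r p p0 <- nq nx ny.
have -> : q * (q * nrm x ^+ 2 + - r * r) + (q * (- r * r) + - r * (- r * q))
    = q * (q * nrm x ^+ 2 - r ^+ 2) by ring.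
rewrite pmulr_rge0// subr_ge0 -nq -exprMn mulrC => H.
rewrite (le_trans (ler_norm _))// -(ger0_norm (mulr_ge0 nx ny)).
by rewrite -ler_sqr ?nnegrE ?normr_ge0// !real_normK ?num_real.
Qed.

End Euclidean.

Lemma expR1_ge2 (R : realType) : 2 <= expR 1 :> R.
Proof. by have := @expR_ge1Dx R 1; rewrite -[1 + 1]/2. Qed.

Lemma expR2_ge4 (R : realType) : 4 <= expR 2 :> R.
Proof.
have e2 := expR1_ge2 R; rewrite (_ : 2 = 1 + 1) ?expRD; last by ring.
by move: (expR 1) e2 => e e2; nra.
Qed.

Lemma sum_geometric_half (R : realType) (N : nat) :
  \sum_(m < N) (2^-1) ^+ m <= 2 - (2^-1) ^+ N * 2 :> R.
Proof.
elim: N => [|N IH]; first by rewrite big_ord0 expr0; lra.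
by rewrite big_ord_recr/= exprS; move: IH; set x := _ ^+ N; lra.
Qed.

Lemma gaussian_sum_le (R : realType) (N : nat) :
  \sum_(m < N) expR (- (m%:R : R) ^+ 2) <= 2.
Proof.
apply: (@le_trans _ _ (\sum_(m < N) (2^-1) ^+ m)).
  apply: ler_sum => m _; apply: (@le_trans _ _ (expR (- (m%:R : R)))).
    rewrite ler_expR lerN2 -natrX ler_nat; case: (nat_of_ord m) => // i.
    by rewrite expnS leq_pmulr.
  rewrite -mulrN1 expRM_natl.
  apply: lerXn2r; rewrite ?nnegrE ?expR_ge0 ?invr_ge0//.
  by rewrite expRN lef_pV2 ?posrE ?expR_gt0 ?expR1_ge2.
apply: (le_trans (sum_geometric_half R N)).
by rewrite gerBl mulr_ge0// exprn_ge0// invr_ge0.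
Qed.

(* The net is the part inside the unit ball of the lattice of mesh
   eps / sqrt k, and coordinates are rounded towards zero.  Its points f are
   counted by a Chernoff bound: each has weight exp (k / eps^2 - sum_j m_j^2)
   at least 1, where h m_j are the moduli of its coordinates. *)
Lemma unit_ball_net (R : realType) (k : nat) (eps : R) : (0 < k)%N -> 0 < eps ->
  exists s : seq 'rV[R]_k,
    [/\ (size s)%:R <= expR (k%:R * (eps ^- 2 + 2)),
        forall v, v \in s -> dot v v <= 1
      & forall u, dot u u <= 1 ->
          exists2 v, v \in s & dot (u - v) (u - v) <= eps ^+ 2].
Proof.
move=> k0 eps0.
have kp : 0 < k%:R :> R by rewrite ltr0n.
pose h : R := eps / Num.sqrt k%:R.
have h0 : 0 < h by rewrite divr_gt0// sqrtr_gt0.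
have h2 : k%:R * h ^+ 2 = eps ^+ 2.
  by rewrite /h expr_div_n sqr_sqrtr ?ler0n// mulrC mulfVK// gt_eqF.
pose N := Num.truncn h^-1.
pose J : finType := ('I_N.+1 * bool)%type.
pose v (f : {ffun 'I_k -> J}) : 'rV[R]_k := \row_j ((-1) ^+ (f j).2 * (h * (f j).1%:R)).
have dotv f : dot (v f) (v f) = h ^+ 2 * \sum_j ((f j).1%:R) ^+ 2.
  rewrite mulr_sumr; apply: eq_bigr => j _; rewrite !mxE mulrACA -expr2.
  by rewrite sqrr_sign mul1r -expr2 exprMn.
pose A := [pred f | dot (v f) (v f) <= 1].
exists [seq v f | f <- enum A]; split.
- rewrite size_map -cardE -sum1_card natr_sum.
  pose F (p : J) := expR (eps ^- 2 - (p.1%:R : R) ^+ 2).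
  apply: (@le_trans _ _ (\sum_(f : {ffun 'I_k -> J}) \prod_j F (f j))).
    rewrite big_mkcond/=; apply: ler_sum => f _; rewrite inE; case: ifPn => [|_].
      rewrite dotv => hf; rewrite -expR_sum -[leLHS]expR0 ler_expR.
      rewrite big_split/= sumrN sumr_const card_ord subr_ge0 -[leRHS]mulr_natl.
      rewrite -(ler_pM2l (exprn_gt0 2 h0)) (le_trans hf)//.
      by rewrite mulrA -[h ^+ 2 * _]mulrC h2 divff// expf_neq0// gt_eqF.
    by apply: prodr_ge0 => j _; exact: expR_ge0.
  rewrite -(bigA_distr_bigA (fun _ : 'I_k => F)) prodr_const card_ord expRM_natl.
  have FE : \sum_(p : J) F p =
      \sum_(m < N.+1) \sum_(b : bool) expR (eps ^- 2 - (m%:R : R) ^+ 2).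
    by rewrite pair_bigA.
  rewrite [X in X ^+ k](_ : _ = \sum_(p : J) F p)// FE.
  apply: lerXn2r.
  - by rewrite nnegrE; do 2 apply: sumr_ge0 => ? _; exact: expR_ge0.
  - by rewrite nnegrE expR_ge0.
  under eq_bigr do rewrite sumr_const card_bool expRD -mulrnAr.
  rewrite -mulr_sumr expRD ler_pM2l ?expR_gt0// sumrMnl.
  (* The two signs times a one-sided sum of at most 2 give 4 <= e^2: this is the [+ 2] of the
     exponent. *)
  apply: le_trans (expR2_ge4 R).
  by rewrite -mulr_natr; have := gaussian_sum_le R N.+1; lra.
- by move=> x /mapP[f]; rewrite mem_enum inE => ? ->.
move=> u u1.
have uj j : `|u ord0 j| <= 1.
  rewrite -ler_sqr ?nnegrE ?normr_ge0// real_normK ?num_real// expr1n.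
  apply: le_trans u1; rewrite /dot (bigD1 j)//= -expr2 lerDl sumr_ge0// => i _.
  by rewrite -expr2 sqr_ge0.
pose m j := Num.truncn (`|u ord0 j| / h).
have mP j : (m j)%:R <= `|u ord0 j| / h < (m j).+1%:R.
  by apply: truncn_itv; rewrite divr_ge0// ltW.
have mN j : (m j < N.+1)%N.
  rewrite -(ltr_nat R); have /andP[m1 _] := mP j; apply: (le_lt_trans m1).
  have /andP[_ ] : N%:R <= h^-1 < N.+1%:R by apply: truncn_itv; rewrite invr_ge0 ltW.
  by apply: le_lt_trans; rewrite ler_piMl// invr_ge0 ltW.
pose f := [ffun j => (Ordinal (mN j), u ord0 j < 0) : J].
have mh j : 0 <= h * (m j)%:R <= `|u ord0 j| /\ `|u ord0 j| - h * (m j)%:R <= h.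
  have /andP[] := mP j; rewrite ler_pdivlMr// ltr_pdivrMr// => a1 a2.
  rewrite mulr_ge0 ?(ltW h0)//= mulrC a1; split=> //.
  by move: a2; rewrite -natr1 mulrDl mul1r lerBlDl => /ltW.
have vf j : v f ord0 j = (-1) ^+ (u ord0 j < 0)%R * (h * (m j)%:R).
  by rewrite mxE ffunE.
have usg j : u ord0 j = (-1) ^+ (u ord0 j < 0)%R * `|u ord0 j|.
  by rewrite [LHS]realEsign ?num_real.
exists (v f).
  (* Rounding towards zero decreases every modulus, so the rounded point stays in the ball. *)
  apply/mapP; exists f => //; rewrite mem_enum inE; apply: le_trans u1.
  apply: ler_sum => j _; rewrite -!expr2 vf exprMn sqrr_sign mul1r.
  have [/andP[b1 b2] _] := mh j.
  by rewrite -[leRHS]real_normK ?num_real// ler_sqr ?nnegrE.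
rewrite -h2 mulr_natl -[X in _ *+ X]card_ord -sumr_const; apply: ler_sum => j _.
rewrite -expr2 !mxE ffunE/= {1}usg -mulrBr exprMn sqrr_sign mul1r.
have [/andP[b1 b2] b3] := mh j.
by rewrite ler_sqr ?nnegrE ?subr_ge0// ltW.
Qed.

Definition half_net (R : realType) (k : nat) (s : seq 'rV[R]_k) :=
  forall u, dot u u <= 1 -> exists2 v, v \in s & dot (u - v) (u - v) <= 2^-1 ^+ 2.

(** With u = x / |x| and v a point of the net within 1/2 of u, |x| = <x, u> <= M + |x| / 2, and the
    last term is absorbed on the left. *)
Lemma nrm_le_net (R : realType) (k : nat) (s : seq 'rV[R]_k) (x : 'rV[R]_k) (M : R) :
  half_net s -> 0 <= M -> (forall v, v \in s -> dot x v <= M) -> nrm x <= 2 * M.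
Proof.
move=> ns M0 xM.
have [x0|x0] := eqVneq (nrm x) 0; first by rewrite x0 mulr_ge0.
have xp : 0 < nrm x by rewrite lt_neqAle eq_sym x0 nrm_ge0.
pose u := (nrm x)^-1 *: x.
have u1 : dot u u <= 1.
  by rewrite dotZl dotZr -sqr_nrm expr2 mulKf// mulVf.
have [v vs uv] := ns u u1.
have xu : dot x u = nrm x by rewrite dotZr -sqr_nrm expr2 mulKf.
have nuv : nrm (u - v) <= 2^-1.
  by rewrite -ler_sqr ?nnegrE ?nrm_ge0 ?invr_ge0// sqr_nrm.
have := dot_le_nrm x (u - v); have := xM v vs.
have E : dot x u = dot x v + dot x (u - v) by rewrite -dotDr subrKC.
move=> xvM xuv; have : nrm x * nrm (u - v) <= nrm x * 2^-1 by rewrite ler_pM2l.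
move: E xvM xuv; rewrite xu; lra.
Qed.

(** [app z] is the action of the matrix with rows [z i], and [comb z] that of its transpose. *)
Definition app (R : realType) (n d : nat) (z : 'I_n -> 'rV[R]_d) (u : 'rV[R]_d) : 'rV[R]_n :=
  \row_i dot (z i) u.

Definition comb (R : realType) (n d : nat) (z : 'I_n -> 'rV[R]_d) (b : 'rV[R]_n) : 'rV[R]_d :=
  \sum_i b ord0 i *: z i.

Lemma dot_suml (R : realType) (n d : nat) (z : 'I_n -> 'rV[R]_d) (u : 'rV[R]_d) :
  dot (\sum_i z i) u = \sum_i dot (z i) u.
Proof.
have d0 : dot 0 u = 0 by rewrite dotC dot0r.
by rewrite (big_morph (fun x => dot x u) (fun x y => dotDl x y u) d0).
Qed.

Lemma dot_comb (R : realType) (n d : nat) (z : 'I_n -> 'rV[R]_d) b u :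
  dot (comb z b) u = dot b (app z u).
Proof.
by rewrite dot_suml; apply: eq_bigr => i _; rewrite dotZl mxE.
Qed.

(** The net argument is used twice, each time at the cost of a factor 2: in R^n it reduces to <b,
    [app z u]> = <[comb z b], u> <= |[comb z b]| |u|, and in R^d it bounds |[comb z b]|. *)
Lemma nrm_app_le_nets (R : realType) (n d : nat) (z : 'I_n -> 'rV[R]_d)
    (sn : seq 'rV[R]_n) (sd : seq 'rV[R]_d) (M : R) :
  half_net sn -> half_net sd -> 0 <= M ->
  (forall b v, b \in sn -> v \in sd -> dot (comb z b) v <= M) ->
  forall u, nrm (app z u) <= 4 * M * nrm u.
Proof.
move=> hn hd M0 H u.
have M2 : 0 <= 2 * M * nrm u by rewrite !mulr_ge0 ?nrm_ge0.
rewrite (_ : 4 * M * nrm u = 2 * (2 * M * nrm u)); last by ring.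
apply: (nrm_le_net hn M2) => b bs; rewrite dotC -dot_comb.
apply: (le_trans (dot_le_nrm _ _)); apply: ler_wpM2r; first exact: nrm_ge0.
by apply: (nrm_le_net hd M0) => v vs; exact: H.
Qed.

(** * Deterministic bounds on the likelihood ratio *)

Lemma expR_le_inv1B (R : realType) (x : R) : x < 1 -> expR x <= (1 - x)^-1.
Proof.
move=> x1; rewrite -[x in leLHS]opprK expRN lef_pV2 ?posrE ?expR_gt0 ?subr_gt0//.
exact: expR_ge1Dx.
Qed.

Lemma inv1B_le (R : realType) (q : R) : 0 <= q <= 1 / 2 -> (1 - q)^-1 <= 1 + 2 * q.
Proof.
move=> /andP[q0 q1]; rewrite -[leLHS]mul1r ler_pdivrMr; first by nra.
by lra.
Qed.

(** The constant 2 (1/2 would be sharp) allows an elementary proof: for x^2 > 1/2, both exponents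
    are at most 2 x^2; otherwise e^x <= 1 / (1 - x), and averaging over the two signs gives 1 / (1 -
    x^2) <= 1 + 2 x^2. *)
Lemma cosh_le (R : realType) (x : R) : (expR x + expR (- x)) / 2 <= expR (2 * x ^+ 2).
Proof.
have [x2|x2] := leP (x ^+ 2) (1 / 2); last first.
  have h1 : expR x <= expR (2 * x ^+ 2) by rewrite ler_expR; nra.
  have h2 : expR (- x) <= expR (2 * x ^+ 2) by rewrite ler_expR; nra.
  lra.
have x1 : x < 1 by nra.
have x1' : - x < 1 by nra.
apply: le_trans (expR_ge1Dx _).
have h1 := expR_le_inv1B x1; have := expR_le_inv1B x1'; rewrite opprK => h2.
apply: (@le_trans _ _ (((1 - x)^-1 + (1 + x)^-1) / 2)); first by lra.
have -> : ((1 - x)^-1 + (1 + x)^-1) / 2 = (1 - x ^+ 2)^-1.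
  by field; do ?(apply/andP; split); rewrite gt_eqF//; nra.
by apply: inv1B_le; rewrite sqr_ge0.
Qed.

Lemma cosh_ge (R : realType) (x : R) :
  expR (Num.min `|x| (x ^+ 2) / 16) <= (expR x + expR (- x)) / 2.
Proof.
wlog x0 : x / 0 <= x.
  move=> H; have [|/ltW x0] := leP 0 x; first exact: H.
  have := H (- x); rewrite oppr_ge0 normrN sqrrN opprK [expR _ + _]addrC; exact.
rewrite ger0_norm//.
have [x1|x1] := leP x 1; last first.
  apply: (@le_trans _ _ (expR (x / 16))); first by rewrite ler_expR ler_pM2r ?ge_min ?lexx.
  have E0 := expR_ge0 (- x).
  (* The last two factors are each at least 1 + 15/32, whose square exceeds 2 and pays for the
     division by 2 in cosh. *)
  have E1 : expR x = expR (x / 16) * expR (15 * x / 32) * expR (15 * x / 32).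
    by rewrite -!expRD; congr expR; field.
  have E2 := expR_ge1Dx (15 * x / 32).
  have E3 : 2 <= expR (15 * x / 32) * expR (15 * x / 32) by nra.
  have E4 := expR_gt0 (x / 16).
  rewrite E1 -mulrA; nra.
apply: (@le_trans _ _ (expR (x ^+ 2 / 16))).
  by rewrite ler_expR ler_pM2r ?ge_min ?lexx ?orbT.
apply: (@le_trans _ _ (1 + x ^+ 2 / 8)).
  have q0 : 0 <= x ^+ 2 / 16 <= 1 / 16 by nra.
  have q1 : x ^+ 2 / 16 < 1 by lra.
  apply: (le_trans (expR_le_inv1B q1)).
  have q2 : 0 <= x ^+ 2 / 16 <= 1 / 2 by lra.
  by apply: (le_trans (inv1B_le q2)); lra.
(* With p = e^{x/2} and q = e^{-x/2}, cosh x = 1 + (p - q)^2 / 2 and p - q >= x / 2. *)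
have a1 := expR_ge1Dx (x / 2).
have b1 : expR (- (x / 2)) <= 1 by rewrite -[leRHS]expR0 ler_expR; lra.
have b0 := expR_ge0 (- (x / 2)).
have ab : expR (x / 2) * expR (- (x / 2)) = 1 by rewrite -expRD subrr expR0.
have -> : expR x = expR (x / 2) * expR (x / 2) by rewrite -expRD; congr expR; field.
have -> : expR (- x) = expR (- (x / 2)) * expR (- (x / 2)) by rewrite -expRD; congr expR; field.
nra.
Qed.

Lemma sigmoid_cosh (R : realType) (t : R) :
  2 * sigmoid t = expR (t / 2) / ((expR (t / 2) + expR (- (t / 2))) / 2).
Proof.
rewrite /sigmoid div1r (_ : - t = - (t / 2) + - (t / 2)); last by field.
rewrite expRD expRN; have := expR_gt0 (t / 2).
move: (expR _) => e e0; field.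
by rewrite !gt_eqF//= addr_gt0// mulr_gt0.
Qed.

Lemma sigmoid_lower (R : realType) (t : R) :
  expR (t / 2 - t ^+ 2 / 2) <= 2 * sigmoid t.
Proof.
have c0 : 0 < (expR (t / 2) + expR (- (t / 2))) / 2.
  by rewrite divr_gt0// addr_gt0 ?expR_gt0.
rewrite sigmoid_cosh expRD ler_pM2l ?expR_gt0// expRN lef_pV2 ?posrE ?expR_gt0//.
by apply: (le_trans (cosh_le _)); rewrite ler_expR; lra.
Qed.

Lemma sigmoid_upper (R : realType) (t : R) :
  2 * sigmoid t <= expR (t / 2 - Num.min `|t| (t ^+ 2) / 64).
Proof.
have c0 : 0 < (expR (t / 2) + expR (- (t / 2))) / 2.
  by rewrite divr_gt0// addr_gt0 ?expR_gt0.
rewrite sigmoid_cosh expRD ler_pM2l ?expR_gt0// [leRHS]expRN lef_pV2 ?posrE ?expR_gt0//.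
apply: le_trans (cosh_ge _); rewrite ler_expR normrM (@ger0_norm _ 2^-1)//.
(* Here 64 = 4 * 16: halving the argument divides the minimum by at most 4. *)
have := normr_ge0 t; rewrite /Num.min; case: ifP => h1; case: ifP => h2; nra.
Qed.

(** Separates the length [r] from the direction and makes the cost linear in |y|: 2 al |y| - al^2 is
    the tangent of y^2 at [al], and its slope is at most 1, so that it lies below both |y| and y^2.
    After summation, only a lower bound on sum_i |y_i| is needed. *)
Lemma min_scale_ge (R : realType) (r al y : R) : 0 <= r -> 0 <= al <= 1 / 2 ->
  Num.min r (r ^+ 2) * (2 * al * `|y| - al ^+ 2) <= Num.min `|r * y| ((r * y) ^+ 2).
Proof.
move=> r0 /andP[al0 al1]; rewrite normrM (ger0_norm r0).
have -> : (r * y) ^+ 2 = r ^+ 2 * `|y| ^+ 2 by rewrite exprMn real_normK ?num_real.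
move: `|y| (normr_ge0 y) => {}y y0.
have h1 : 2 * al * y - al ^+ 2 <= y by nra.
have h2 : 2 * al * y - al ^+ 2 <= y ^+ 2.
  by have := sqr_ge0 (y - al); rewrite sqrrB; lra.
have r2 := sqr_ge0 r.
have m0 : 0 <= Num.min r (r ^+ 2) by rewrite le_min r0.
have m1 : Num.min r (r ^+ 2) <= r by rewrite ge_min lexx.
have m2 : Num.min r (r ^+ 2) <= r ^+ 2 by rewrite ge_min lexx orbT.
rewrite le_min; apply/andP; split.
  by apply: (le_trans (ler_wpM2l m0 h1)); exact: ler_wpM2r.
by apply: (le_trans (ler_wpM2l m0 h2)); apply: ler_wpM2r => //; exact: sqr_ge0.
Qed.

Section LikelihoodRatio.
Variables (R : realType) (n d : nat) (z : 'I_n -> 'rV[R]_d).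

(* The likelihood ratio prod_i 2 sigma(<z_i, theta>) in terms of the signed
   covariates z_i = Y_i X_i. *)
Definition lratio (theta : 'rV[R]_d) : R := \prod_i (2 * sigmoid (dot (z i) theta)).

Lemma lratio_ge (theta : 'rV[R]_d) :
  expR (\sum_i dot (z i) theta / 2 - \sum_i (dot (z i) theta) ^+ 2 / 2) <= lratio theta.
Proof.
rewrite -sumrB expR_sum; apply: ler_prod => i _.
by rewrite expR_ge0 sigmoid_lower.
Qed.

Lemma sigmoid_gt0 (t : R) : 0 < sigmoid t.
Proof. by rewrite divr_gt0// addr_gt0// expR_gt0. Qed.

Lemma lratio_le (theta : 'rV[R]_d) :
  lratio theta <= expR (\sum_i dot (z i) theta / 2
                        - (\sum_i Num.min `|dot (z i) theta| (dot (z i) theta ^+ 2)) / 64).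
Proof.
rewrite mulr_suml -sumrB expR_sum; apply: ler_prod => i _.
by rewrite sigmoid_upper mulr_ge0// ltW// sigmoid_gt0.
Qed.

Variable K : R.
Hypothesis K0 : 0 < K.
Hypothesis op : forall u, nrm (app z u) <= Num.sqrt (K * n%:R) * nrm u.
Hypothesis n0 : (0 < n)%N.

Lemma sum_sqr_le u : \sum_i (dot (z i) u) ^+ 2 <= K * n%:R * dot u u.
Proof.
have -> : \sum_i (dot (z i) u) ^+ 2 = nrm (app z u) ^+ 2.
  by rewrite sqr_nrm; apply: eq_bigr => i _; rewrite !mxE expr2.
have Kn0 : 0 <= K * n%:R by rewrite mulr_ge0 ?ler0n ?ltW.
rewrite -[in leRHS](sqr_sqrtr Kn0) -sqr_nrm -exprMn.
by apply: lerXn2r (op u); rewrite nnegrE ?mulr_ge0 ?nrm_ge0 ?sqrtr_ge0.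
Qed.

Lemma lratio_score_ge :
  exists theta, expR (dot (\sum_i z i) (\sum_i z i) / (8 * K * n%:R)) <= lratio theta.
Proof.
set S := \sum_i z i; have np : 0 < n%:R :> R by rewrite ltr0n.
(* [r *: S] maximises <S, theta>/2 - K n |theta|^2 / 2, the minorant of the log-ratio; the maximum
   is |S|^2 / (8 K n). *)
pose r : R := (2 * K * n%:R)^-1; exists (r *: S).
apply: le_trans (lratio_ge _); rewrite ler_expR -!mulr_suml -dot_suml.
have := sum_sqr_le (r *: S); set Q := \sum_i _ ^+ 2 => HQ.
rewrite dotZr; move: HQ; rewrite dotZr dotZl -/S.
move: (dot S S) (dot_ge0 S) => s s0.
pose q := s / (8 * K * n%:R).
have -> : K * n%:R * (r * (r * s)) = 2 * q.
  by rewrite /r /q; field; rewrite !gt_eqF.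
have -> : r * s = 4 * q by rewrite /r /q; field; rewrite !gt_eqF.
by rewrite -/q; lra.
Qed.

Hypothesis K23 : Num.sqrt K <= 23.
Variable a : R.
Hypothesis a01 : 0 < a <= 1.

(** Cauchy-Schwarz against the vector of ones costs sqrt n, and sqrt n * sqrt (K n) = sqrt K * n. *)
Lemma sum_abs_le u : \sum_i `|dot (z i) u| <= 23 * n%:R * nrm u.
Proof.
pose c : 'rV[R]_n := \row_i `|dot (z i) u|.
have -> : \sum_i `|dot (z i) u| = dot (const_mx 1) c.
  by apply: eq_bigr => i _; rewrite !mxE mul1r.
apply: (le_trans (dot_le_nrm _ _)).
have -> : nrm (const_mx 1 : 'rV[R]_n) = Num.sqrt n%:R.
  by congr Num.sqrt; rewrite /dot; under eq_bigr do rewrite !mxE mulr1; rewrite sumr_const card_ord.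
have -> : nrm c = nrm (app z u).
  by congr Num.sqrt; apply: eq_bigr => i _; rewrite !mxE -!expr2 real_normK ?num_real.
have := op u; rewrite (sqrtrM _ (ltW K0)) => H.
have sn : Num.sqrt (n%:R : R) * Num.sqrt n%:R = n%:R by rewrite -expr2 sqr_sqrtr.
apply: (le_trans (ler_wpM2l (sqrtr_ge0 _) H)).
rewrite (_ : _ * (_ * _ * _) = Num.sqrt K * (Num.sqrt n%:R * Num.sqrt n%:R) * nrm u); last by ring.
rewrite sn.
by rewrite ler_wpM2r ?nrm_ge0// ler_wpM2r.
Qed.

Variable s : seq 'rV[R]_d.
Hypothesis net : forall u, dot u u <= 1 ->
  exists2 v, v \in s & dot (u - v) (u - v) <= (a / 100) ^+ 2.
Hypothesis spread : forall v, v \in s -> 1 / 4 <= dot v v ->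
  (n <= 2 * #|[set i | (a <= `|dot (z i) v|)%R]%SET|)%N.

(** At a point v of the net near u, half of the rows contribute at least [a] each, hence a n / 2 in
    total. Going back from v to u costs at most 23 n * a / 100 < a n / 4, which is the reason for
    the mesh [a / 100]. The points of the net that occur have |v|^2 >= 1/4, so [spread] is only
    needed for those. *)
Lemma sum_abs_ge u : dot u u = 1 -> a * n%:R / 4 <= \sum_i `|dot (z i) u|.
Proof.
move=> u1; have [|v vs uv] := net (u := u); first by rewrite u1.
have /andP[a0 a1] := a01.
have e0 : 0 <= a / 100 by rewrite divr_ge0// ltW.
have nuv : nrm (u - v) <= a / 100.
  by rewrite -ler_sqr ?nnegrE ?nrm_ge0// sqr_nrm.
have nu : nrm u = 1 by rewrite /nrm u1 sqrtr1.
have dv : 1 / 4 <= dot v v.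
  have -> : dot v v = dot (u + - 1 *: (u - v)) (u + - 1 *: (u - v)).
    by rewrite scaleN1r opprB subrKC.
  have := dot_le_nrm u (u - v); have := dot_ge0 (u - v); rewrite nu mul1r.
  move: nuv; move: (u - v) => w nw w0 uw.
  rewrite !(dotDl, dotDr, dotZl, dotZr) u1 (dotC w u); lra.
have := spread vs dv; rewrite -(ler_nat R) natrM; set c := #|_| => hc.
have hv : a * c%:R <= \sum_i `|dot (z i) v|.
  rewrite /c -sum1_card natr_sum mulr_sumr big_mkcond/=; apply: ler_sum => i _.
  by rewrite inE; case: ifP => [|_]; rewrite ?mulr1// normr_ge0.
have tri : \sum_i `|dot (z i) v| <= \sum_i `|dot (z i) u| + \sum_i `|dot (z i) (u - v)|.
  rewrite -big_split/=; apply: ler_sum => i _.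
  have -> : dot (z i) v = dot (z i) u - dot (z i) (u - v).
    by rewrite -mulN1r -dotZr -dotDr scaleN1r opprB subrKC.
  exact: ler_normB.
have := sum_abs_le (u - v) => h1.
have np : 0 <= n%:R :> R by [].
have h2 : 23 * n%:R * nrm (u - v) <= 23 * n%:R * (a / 100).
  by apply: ler_wpM2l => //; rewrite mulr_ge0.
have h3 : a * n%:R <= a * (2 * c%:R) by rewrite ler_pM2l.
have h4 : 0 <= a * n%:R by rewrite mulr_ge0// ltW.
move: h1 h2 h3 h4 hv tri; set A := \sum_i _; set B := \sum_i _; set D := \sum_i _.
lra.
Qed.

(** With x = |S|, r = |theta| and b = a^2 n / 16, the exponent is at most x r / 2 - min (r, r^2) b /
    64. If r <= r^2, this is nonpositive because x <= b / 32; otherwise, completing the square in r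
    gives 4 x^2 / b. *)
Lemma lratio_score_le theta :
  nrm (\sum_i z i) <= a ^+ 2 / 16 * n%:R / 32 ->
  lratio theta <= expR (4 * dot (\sum_i z i) (\sum_i z i) / (a ^+ 2 / 16 * n%:R)).
Proof.
have /andP[a0 a1] := a01.
move=> Sn; apply: (le_trans (lratio_le _)); rewrite ler_expR -mulr_suml -dot_suml.
set S := \sum_i z i in Sn *.
have np : 0 < n%:R :> R by rewrite ltr0n.
have an0 : 0 < a ^+ 2 / 16 * n%:R by rewrite mulr_gt0// divr_gt0// exprn_gt0.
pose r := nrm theta; have r0 : 0 <= r := nrm_ge0 _.
have Sth : dot S theta <= nrm S * r := dot_le_nrm _ _.
have main : Num.min r (r ^+ 2) * (a ^+ 2 / 16 * n%:R) <=
    \sum_i Num.min `|dot (z i) theta| (dot (z i) theta ^+ 2).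
  have [rz|rz] := eqVneq r 0.
    rewrite rz expr0n/= minxx mul0r; apply: sumr_ge0 => i _.
    by rewrite le_min normr_ge0 sqr_ge0.
  have rp : 0 < r by rewrite lt_neqAle eq_sym rz.
  pose u := r^-1 *: theta.
  have u1 : dot u u = 1 by rewrite dotZl dotZr -sqr_nrm -/r; field.
  have thu : theta = r *: u by rewrite scalerA mulfV// scale1r.
  (* The tangent point [a / 4] is matched to [sum_abs_ge]: 2 (a/4) (a n / 4) - n (a/4)^2 = a^2 n /
     16. *)
  apply: (@le_trans _ _ (\sum_i Num.min r (r ^+ 2) * (2 * (a / 4) * `|dot (z i) u| - (a / 4) ^+ 2))).
    rewrite -mulr_sumr; apply: ler_wpM2l; first by rewrite le_min r0 sqr_ge0.
    rewrite sumrB -mulr_sumr sumr_const card_ord -[_ *+ n]mulr_natl.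
    have := sum_abs_ge u1; set N := \sum_i _ => HN.
    have : a * (a * n%:R / 4) <= a * N by rewrite ler_pM2l.
    lra.
  apply: ler_sum => i _.
  have -> : dot (z i) theta = r * dot (z i) u by rewrite -dotZr -thu.
  by apply: min_scale_ge => //; lra.
rewrite -(sqr_nrm S).
move: (nrm S) (nrm_ge0 S) Sn Sth => x x0; move: (a ^+ 2 / 16 * n%:R) an0 main => b b0.
set Q := \sum_i _; set y := dot _ _ => main xb yx.
apply: (@le_trans _ _ (x * r / 2 - Num.min r (r ^+ 2) * b / 64)); first by lra.
have [r1|r1] := leP r (r ^+ 2).
  have : x * r <= b / 32 * r by rewrite ler_wpM2r.
  have : 0 <= 4 * x ^+ 2 / b by rewrite divr_ge0 ?(ltW b0)// mulr_ge0// sqr_ge0.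
  lra.
rewrite ler_pdivlMr//.
have := sqr_ge0 (2 * x - r * b / 8); nra.
Qed.

End LikelihoodRatio.

(** * Linear combinations of independent normal variables *)

(** By uniqueness of Lebesgue measure, the right-hand side need only be computed on half-open
    intervals; for s < 0 their preimages are closed on the other side, which does not change the
    length. *)
Lemma lebesgue_measure_affine (R : realType) (s m : R) (A : set R) :
  s != 0 -> measurable A ->
  lebesgue_measure A =
    (`|s|%:E * lebesgue_measure ((fun u : R => s * u + m)%R @^-1` A))%E.
Proof.
move=> s0 mA.
pose g : measurableTypeR R -> measurableTypeR R := fun u => s * u + m.
have mg : measurable_fun setT g.
  by apply: measurable_funD => //; apply: measurable_funM.
pose k : {nonneg R} := NngNum (normr_ge0 s).
pose nu0 : {measure set (measurableTypeR R) -> \bar R} :=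
  mscale k (pushforward (@lebesgue_measure R) g).
pose nu := nu0 mg.
apply: (@lebesgue_measure_unique R nu) => // X [[x y] /= xy <-].
rewrite /nu /nu0 /mscale/= /pushforward /= /g.
have [sn|sp] := leP s 0.
  have {}sn : s < 0 by rewrite lt_neqAle s0.
  have -> : (fun u => s * u + m) @^-1` `]x, y] =
      `[(y - m) / s, (x - m) / s[%classic.
    apply/seteqP; split => u /=; rewrite !in_itv/= ltr_ndivlMr// ler_ndivrMr//;
    by rewrite ltrBlDr lerBrDr mulrC andbC.
  rewrite [in RHS]lebesgue_measure_itv [in LHS]lebesgue_measure_itv/= !lte_fin.
  rewrite ltr_nM2r ?invr_lt0// ltrD2r.
  case: ifP => _; last by rewrite mule0.
  rewrite -!EFinB -EFinM; congr EFin; rewrite ltr0_norm//.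
  by field; rewrite lt_eqF.
have -> : (fun u => s * u + m) @^-1` `]x, y] =
    `](x - m) / s, (y - m) / s]%classic.
  apply/seteqP; split => u /=; rewrite !in_itv/= ltr_pdivrMr// ler_pdivlMr//;
  by rewrite ltrBlDr lerBrDr mulrC.
rewrite [in RHS]lebesgue_measure_itv [in LHS]lebesgue_measure_itv/= !lte_fin.
rewrite ltr_pM2r ?invr_gt0// ltrD2r.
case: ifP => _; last by rewrite mule0.
rewrite -!EFinB -EFinM; congr EFin; rewrite gtr0_norm//.
by field; rewrite gt_eqF.
Qed.

Lemma ge0_integral_lebesgue_affine (R : realType) (s m : R) (f : R -> \bar R)
    (A : set R) :
  s != 0 -> measurable A -> measurable_fun setT f -> (forall x, (0 <= f x)%E) ->
  (\int[lebesgue_measure]_(x in A) f x =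
   `|s|%:E * \int[lebesgue_measure]_(u in (fun u : R => s * u + m)%R @^-1` A)
      f (s * u + m)%R)%E.
Proof.
move=> s0 mA mf f0.
pose g : measurableTypeR R -> measurableTypeR R := fun u => s * u + m.
have mg : measurable_fun setT g.
  by apply: measurable_funD => //; apply: measurable_funM.
pose k : {nonneg R} := NngNum (normr_ge0 s).
pose nu0 : {measure set (measurableTypeR R) -> \bar R} :=
  (pushforward (@lebesgue_measure R) g).
pose nu := nu0 mg.
transitivity (\int[mscale k nu]_(x in A) f x)%E.
  apply: eq_measure_integral => B mB _.
  by rewrite /mscale/= (lebesgue_measure_affine m s0 mB).
rewrite ge0_integral_mscale//=; last exact: measurable_funTS.
by rewrite ge0_integral_pushforward//; exact: measurable_funTS.
Qed.

Lemma normal_prob_affine (R : realType) (s m : R) (A : set R) :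
  s != 0 -> measurable A ->
  normal_prob m s A = normal_prob 0 1 ((fun u => s * u + m) @^-1` A).
Proof.
move=> s0 mA; rewrite /normal_prob (ge0_integral_lebesgue_affine m s0 mA); last 2 first.
- by apply/measurable_EFinP; exact: measurable_normal_pdf.
- by move=> x; rewrite lee_fin normal_pdf_ge0.
rewrite -ge0_integralZl//; last 3 first.
- rewrite -[X in measurable X]setTI; have mg : measurable_fun setT (fun u : R => s * u + m).
    by apply: measurable_funD => //; apply: measurable_funM.
  exact: mg.
- apply/measurable_EFinP/measurable_funTS.
  apply: measurableT_comp; first exact: measurable_normal_pdf.
  by apply: measurable_funD => //; apply: measurable_funM.
- by move=> x _; rewrite lee_fin normal_pdf_ge0.
apply: eq_integral => u _; rewrite -EFinM; congr EFin.
rewrite !normal_pdfE ?oner_neq0// /normal_fun addrK subr0 mulrA; congr (_ * expR _).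
  rewrite /normal_peak expr1n mul1r -mulrnAr sqrtrM ?sqr_ge0// sqrtr_sqr.
  by rewrite invfM mulrA divff ?normr_eq0// mul1r.
by field.
Qed.

(** The Radon-Nikodym derivative of [normal_prob] agrees almost everywhere with [normal_pdf], as
    both have the same integral over every measurable set. The bounds on [f] provide
    integrability. *)
Lemma integral_normal_prob (R : realType) (m s : R) (f : R -> \bar R) :
  measurable_fun setT f -> (forall x, 0 <= f x <= 1)%E ->
  (\int[normal_prob m s]_x f x =
   \int[lebesgue_measure]_x (f x * (normal_pdf m s x)%:E))%E.
Proof.
move=> mf f01.
have mp : measurable_fun (setT : set (measurableTypeR R))
    (fun x => (normal_pdf m s x)%:E).
  by apply/measurable_EFinP; exact: measurable_normal_pdf.
have dom := @normal_prob_dominates R m s.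
have intf : (normal_prob m s).-integrable setT f.
  apply/integrableP; split => //.
  apply: (@le_lt_trans _ _ (\int[normal_prob m s]_x cst 1%E x)%E); last first.
    by rewrite integral_cst//= mul1e probability_setT ltry.
  apply: ge0_le_integral => //; first by apply: measurableT_comp.
  by move=> x _; have /andP[? ?] := f01 x; rewrite gee0_abs.
rewrite -(Radon_Nikodym_change_of_variables dom)//=.
apply: ae_eq_integral => //.
- by apply: emeasurable_funM.
- exact: (emeasurable_funM (mf : measurable_fun (setT : set (measurableTypeR R)) f) mp).
apply: ae_eqe_mul2l.
apply: integral_ae_eq => //=.
- exact: (@Radon_Nikodym_integrable _ _ _ (charge_of_finite_measure (normal_prob m s)) _ dom).
- by move=> E _ mE; rewrite -(@Radon_Nikodym_integral _ _ _
    (charge_of_finite_measure (normal_prob m s)) _ _ dom mE).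
Qed.

(** Two factorisations of the joint density of (u, s u + a v) for independent standard normal u and
    v. On the right stands the marginal of the sum times the conditional density of u, so that
    integrating in u leaves the marginal. *)
Lemma normal_pdf_convolution (R : realType) (s a u y : R) : s != 0 -> a != 0 ->
  let r := Num.sqrt (s ^+ 2 + a ^+ 2) in
  normal_pdf (s * u) a y * normal_pdf 0 1 u =
  normal_pdf 0 r y * normal_pdf (s * y / r ^+ 2) (a / r) u.
Proof.
move=> s0 a0 r.
have r2 : r ^+ 2 = s ^+ 2 + a ^+ 2 by rewrite sqr_sqrtr// addr_ge0 ?sqr_ge0.
have sa0 : 0 < s ^+ 2 + a ^+ 2 by rewrite ltr_pwDl ?sqr_ge0// exprn_even_gt0.
have r0 : 0 < r by rewrite sqrtr_gt0.
clearbody r.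
have rn0 : r != 0 by rewrite gt_eqF.
rewrite !normal_pdfE ?oner_neq0 ?mulf_neq0 ?invr_neq0//.
rewrite /normal_fun mulrACA [RHS]mulrACA; congr (_ * _).
  have pk (x : R) : 0 <= x ^+ 2 * pi *+ 2.
    by rewrite mulrn_wge0// mulr_ge0 ?sqr_ge0 ?pi_ge0.
  rewrite /normal_peak -!invfM -!sqrtrM ?pk//.
  congr (Num.sqrt _)^-1; rewrite exprMn exprVn expr1n mul1r.
  move: (pi : R) => p.
  by field.
rewrite -!expRD; congr expR; rewrite r2.
rewrite expr_div_n r2; field.
by rewrite a0 (gt_eqF sa0).
Qed.

Lemma normal_convolution (R : realType) (s a : R) (A : set R) :
  s != 0 -> a != 0 -> measurable A ->
  (normal_prob 0 1 \x normal_prob 0 1)%E [set p : R * R | A (s * p.1 + a * p.2)]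
   = normal_prob 0 (Num.sqrt (s ^+ 2 + a ^+ 2)) A.
Proof.
move=> s0 a0 mA; set r := Num.sqrt _.
have mn (b : R) (m : R) : b != 0 -> measurable_fun setT (fun x : R => (normal_pdf m b x)%:E).
  by move=> b0; apply/measurable_EFinP; exact: measurable_normal_pdf.
have mD : measurable [set p : R * R | A (s * p.1 + a * p.2)].
  rewrite -[X in measurable X]setTI.
  have mf : measurable_fun setT (fun p : R * R => s * p.1 + a * p.2).
    by apply: measurable_funD; apply: measurable_funM.
  exact: mf.
have E u : normal_prob 0 1 (xsection [set p : R * R | A (s * p.1 + a * p.2)] u)
    = normal_prob (s * u) a A.
  rewrite [RHS]normal_prob_affine//; congr (normal_prob 0 1 _).
  by apply/seteqP; split => v; rewrite /xsection/= inE/= addrC.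
rewrite /product_measure1.
pose g (p : R * R) := ((\1_A p.2 : R)%:E * (normal_pdf (s * p.1) a p.2 * normal_pdf 0 1 p.1)%:E)%E.
have mg : measurable_fun setT g.
  apply: emeasurable_funM.
    apply/measurable_EFinP; apply: (@measurableT_comp _ _ _ _ _ _ (\1_A : R -> R)) => //.
  apply/measurable_EFinP; apply: measurable_funM; last first.
    by apply: measurableT_comp => //; exact: measurable_normal_pdf.
  rewrite (_ : (fun _ => _) = fun p : R * R => normal_pdf 0 a (p.2 - s * p.1)); last first.
    by apply/funext => p; rewrite !normal_pdfE// /normal_fun subr0.
  apply: measurableT_comp; first exact: measurable_normal_pdf.
  by apply: measurable_funB => //; apply: measurable_funM.
have g0 p : (0 <= g p)%E by rewrite mule_ge0// lee_fin ?mulr_ge0 ?normal_pdf_ge0.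
rewrite integral_normal_prob/=; last 2 first.
- exact (@measurable_fun_xsection _ _ (measurableTypeR R) (measurableTypeR R) R (normal_prob 0 1) _ mD).
- move=> u; rewrite E; apply/andP; split; first by apply: integral_ge0 => x _; rewrite lee_fin normal_pdf_ge0.
  exact: probability_le1.
transitivity (\int[lebesgue_measure]_u \int[lebesgue_measure]_y g (u, y))%E.
  apply: eq_integral => u _ /=; rewrite E /normal_prob muleC.
  rewrite -ge0_integralZl ?lee_fin ?normal_pdf_ge0//; last first.
  - by move=> y _; rewrite lee_fin normal_pdf_ge0.
  - exact: measurable_funTS (mn _ _ a0).
  rewrite integral_mkcond; apply: eq_integral => y _.
  rewrite /g/= patchE indicE; case: (y \in A) => /=; last by rewrite mul0e.
  by rewrite mul1e -EFinM mulrC.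
rewrite (fubini_tonelli (m1 := lebesgue_measure) (m2 := lebesgue_measure) g)//=.
rewrite /normal_prob [RHS]integral_mkcond; apply: eq_integral => y _.
have r0 : 0 < r by rewrite sqrtr_gt0 ltr_pwDl ?sqr_ge0// exprn_even_gt0.
rewrite patchE /g/= indicE; case: (y \in A) => /=; last first.
  under eq_integral do rewrite mul0e.
  exact: integral0.
under eq_integral do rewrite mul1e normal_pdf_convolution// EFinM.
rewrite ge0_integralZl ?lee_fin ?normal_pdf_ge0//.
- by rewrite integral_normal_pdf mule1.
- by apply: mn; rewrite mulf_neq0// invr_neq0// gt_eqF.
- by move=> x _; rewrite lee_fin normal_pdf_ge0.
Qed.

Definition scaling (R : realType) (s : R) (u : measurableTypeR R) : R := s * u.

HB.instance Definition _ (R : realType) (s : R) :=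
  isMeasurableFun.Build _ _ (measurableTypeR R) R (@scaling R s)
    (mulrl_measurable s).

(* The law of [s * Z] for Z standard normal: unlike the library's
   [normal_prob 0 s], it degenerates correctly (to a Dirac mass) at [s = 0]. *)
Definition gauss (R : realType) (s : R) : probability R R :=
  distribution (normal_prob 0 1) (@scaling R s).

Lemma gaussE (R : realType) (s : R) (A : set R) :
  gauss s A = normal_prob 0 1 ((fun u => s * u) @^-1` A).
Proof. by []. Qed.

Lemma gauss_normal_prob (R : realType) (s : R) (A : set R) :
  s != 0 -> measurable A -> gauss s A = normal_prob 0 s A.
Proof.
move=> s0 mA; rewrite normal_prob_affine// gaussE; congr (normal_prob 0 1 _).
by apply/seteqP; split => u /=; rewrite addr0.
Qed.

Lemma gauss_norm (R : realType) (s : R) (A : set R) :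
  measurable A -> gauss `|s| A = gauss s A.
Proof.
move=> mA; have [->|s0] := eqVneq s 0; first by rewrite normr0.
rewrite !gauss_normal_prob ?normr_eq0//; apply: eq_integral => x _.
rewrite !normal_pdfE ?normr_eq0// /normal_peak /normal_fun.
by rewrite real_normK ?num_real.
Qed.

(** Zero scales are included because coefficients of a linear form may vanish. In these cases one
    law is a Dirac mass and the sum reduces to the other variable; the remaining case is
    [normal_convolution]. *)
Lemma gauss_convolution (R : realType) (s a : R) (A : set R) : measurable A ->
  (gauss s \x gauss a)%E [set p : R * R | A (p.1 + p.2)]
   = gauss (Num.sqrt (s ^+ 2 + a ^+ 2)) A.
Proof.
move=> mA.
have mD : measurable [set p : R * R | A (p.1 + p.2)].
  rewrite -[X in measurable X]setTI.
  have mf : measurable_fun setT (fun p : R * R => p.1 + p.2).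
    exact: measurable_funD.
  exact: mf.
have -> : (gauss s \x gauss a)%E [set p : R * R | A (p.1 + p.2)] =
  (\int[normal_prob 0 1]_u normal_prob 0 1 [set v | A (s * u + a * v)%R])%E.
  rewrite /product_measure1 /gauss ge0_integral_distribution//.
  - apply: eq_integral => u _ /=; rewrite /distribution /pushforward.
    by congr (normal_prob 0 1 _); apply/seteqP; split => v; rewrite /xsection/= inE.
  - exact: measurable_fun_xsection.
have gn (x y : R) : x = 0 -> gauss (Num.sqrt (x ^+ 2 + y ^+ 2)) A = gauss y A.
  by move=> ->; rewrite expr0n/= add0r sqrtr_sqr; exact: gauss_norm.
have [s0|s0] := eqVneq s 0.
  rewrite gn// s0; under eq_integral => u _.
    rewrite (_ : [set v | A (0 * u + a * v)%R] = (fun v => a * v)%R @^-1` A); last first.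
      by apply/seteqP; split => v /=; rewrite mul0r add0r.
    rewrite -gaussE; over.
  rewrite -(@fineK _ (gauss a A)) ?fin_num_measure//.
  by rewrite integral_cst//= probability_setT mule1.
have [a0|a0] := eqVneq a 0.
  rewrite addrC gn// a0; under eq_integral => u _.
    rewrite (_ : [set v | A (s * u + 0 * v)%R] = if (s * u)%R \in A then setT else set0); last first.
      by case: ifPn => [|/negP]; rewrite inE => Asu;
        apply/seteqP; split => v //=; rewrite mul0r addr0.
    rewrite (_ : normal_prob 0 1 _ = (\1_((fun u : measurableTypeR R => s * u)%R @^-1` A) u)%:E); last first.
      rewrite indicE (_ : (u \in _) = (s * u \in A)); last by apply/idP/idP; rewrite !inE.
      by case: (s * u \in A); rewrite ?measure0 ?probability_setT.
    over.
  rewrite integral_indic ?setIT//.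
  rewrite -[X in measurable X]setTI.
  exact: mulrl_measurable.
rewrite gauss_normal_prob//; last first.
  by rewrite gt_eqF// sqrtr_gt0 ltr_pwDl ?sqr_ge0// exprn_even_gt0.
rewrite -normal_convolution// /product_measure1.
apply: eq_integral => u _ /=; congr (normal_prob 0 1 _).
by apply/seteqP; split => v; rewrite /xsection/= inE.
Qed.

(* Keeping the event [E] lets [gauss_linear_combination] peel off one variable
   at a time, with the remaining ones still constrained by [E]. *)
Lemma joint_law_on_event (R : realType) (d : measure_display)
    (T : measurableType d) (P : probability T R) (U V : T -> R) (E : set T)
    (mu nu : probability R R) :
  measurable_fun setT U -> measurable_fun setT V -> measurable E ->
  (forall A B, measurable A -> measurable B ->
    P (U @^-1` A `&` V @^-1` B `&` E) = (mu A * nu B * P E)%E) ->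
  forall D, measurable D ->
    P ((fun w => (U w, V w)) @^-1` D `&` E) = ((mu \x nu) D * P E)%E.
Proof.
move=> mU mV mE PE D mD.
pose UV := fun w => (U w, V w).
have mUV : measurable_fun setT UV by exact: measurable_fun_pair.
have mUVD : measurable (UV @^-1` D) by rewrite -[X in measurable X]setTI; exact: mUV.
have PEfin : P E \is a fin_num by rewrite fin_num_measure.
have [E0|E0] := eqVneq (P E) 0%E.
  rewrite E0 mule0; apply/eqP; rewrite eq_le measure_ge0//.
  by rewrite andbT -E0 le_measure ?inE//; exact: measurableI.
have E1 : (0 < P E)%E by rewrite lt0e E0 measure_ge0.
have c0 : 0 < fine (P E) by rewrite fine_gt0// E1 ltey_eq PEfin.
have ci0 : 0 <= (fine (P E))^-1 by rewrite invr_ge0 ltW.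
pose k : {nonneg R} := NngNum ci0.
(* The conditional law of the pair given [E], identified with the product measure by its values on
   rectangles. *)
pose m0 : {measure set (R * R) -> \bar R} := mscale k (pushforward (mrestr P mE) UV).
pose m := m0 mUV.
have mk B : m B = ((fine (P E))^-1%:E * P (UV @^-1` B `&` E))%E by [].
have H := @product_measure_unique _ _ _ _ R mu nu m.
rewrite H//; first rewrite mk muleAC -[X in (_ * X * _)%E]fineK//.
  by rewrite -EFinM mulVf ?gt_eqF// mul1e.
move=> A B mA mB; rewrite mk (_ : UV @^-1` (A `*` B) = U @^-1` A `&` V @^-1` B)//.
rewrite PE// muleCA -[X in (_ * X)%E]muleC -[X in (_ * (X * _))%E]fineK//.
by rewrite -[LHS]muleA -EFinM mulfV ?gt_eqF// mule1.
Qed.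

Lemma measurable_preimageT (d d' : measure_display) (T : measurableType d)
    (T' : measurableType d') (f : T -> T') (A : set T') :
  measurable_fun setT f -> measurable A -> measurable (f @^-1` A).
Proof. by move=> mf mA; rewrite -[X in measurable X]setTI; exact: mf. Qed.

Lemma gauss_linear_combination (R : realType) (d : measure_display)
    (T : measurableType d) (P : probability T R) (n : nat)
    (W : 'I_n -> T -> R) (a s : 'I_n -> R) (A : set R) :
  (forall i, measurable_fun setT (W i)) ->
  mutually_independent P W ->
  (forall i B, measurable B -> P (W i @^-1` B) = gauss (s i) B) ->
  measurable A ->
  P [set w | A (\sum_i a i * W i w)]
    = gauss (Num.sqrt (\sum_i (a i * s i) ^+ 2)) A.
Proof.
move=> mW indW lawW mA.
pose S m w := \sum_(i < n | (i < m)%N) a i * W i w.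
pose E m (B : 'I_n -> set R) := [set w | forall i : 'I_n, (m <= i)%N -> B i (W i w)].
have EE m B : E m B = [set w | forall i, i \in [set j : 'I_n | (m <= j)%N]%SET -> B i (W i w)].
  by apply/seteqP; split => w /= H i; [rewrite inE; exact: H|
     move=> im; apply: H; rewrite inE].
have PE m B : (forall i, measurable (B i)) ->
    P (E m B) = (\prod_(i < n | (m <= i)%N) P (W i @^-1` B i))%E.
  move=> mB; rewrite EE indW//; apply: eq_bigl => i; by rewrite inE.
have mE m B : (forall i, measurable (B i)) -> measurable (E m B).
  move=> mB; apply: (@fin_bigcap_measurable _ _ _ [set i : 'I_n | (m <= i)%N]
    (fun i => W i @^-1` B i)); first exact: finite_finset.
  by move=> i _; exact: measurable_preimageT.
have mS m : measurable_fun setT (S m).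
  rewrite (_ : S m = fun w => \sum_(i < n) (if (i < m)%N then a i * W i w else 0)).
    apply: measurable_sum => i; case: (i < m)%N; first exact: measurable_funM.
    exact: measurable_cst.
  by apply/funext => w; rewrite /S big_mkcond.
(* The induction carries both the law of the partial sum and its independence from arbitrary
   constraints on the variables not yet summed. *)
suff H m : (m <= n)%N -> forall A B, measurable A -> (forall i, measurable (B i)) ->
    P (S m @^-1` A `&` E m B) =
    (gauss (Num.sqrt (\sum_(i < n | (i < m)%N) (a i * s i) ^+ 2)) A * P (E m B))%E.
  have := H n (leqnn n) A (fun=> setT) mA (fun=> measurableT).
  rewrite (_ : E n _ = setT); last by apply/seteqP; split.
  rewrite setIT probability_setT mule1 => H'.
  rewrite (_ : [set w | _] = S n @^-1` A); last first.
    apply/seteqP; split => w; rewrite /S /=;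
    (suff -> : \sum_(i < n | (i < n)%N) a i * W i w = \sum_i a i * W i w by []);
    by apply: eq_bigl => i; rewrite ltn_ord.
  by rewrite H'; congr (gauss (Num.sqrt _) A); apply: eq_bigl => i; rewrite ltn_ord.
elim: m => [_|m IH mn] {}A B {}mA mB.
  rewrite (_ : S 0 = fun=> 0); last by apply/funext => w; rewrite /S big_pred0_eq.
  rewrite big_pred0_eq sqrtr0 preimage_cst gaussE.
  rewrite (_ : (fun _ => _) = fun=> 0); last by apply/funext => u; rewrite mul0r.
  rewrite preimage_cst; case: (0 \in A); first by rewrite setTI probability_setT mul1e.
  by rewrite set0I !measure0 mul0e.
pose i0 := Ordinal mn.
pose V w := a i0 * W i0 w.
have mV : measurable_fun setT V by apply: measurable_funM.
have SE : S m.+1 = fun w => S m w + V w.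
  apply/funext => w; rewrite /S (bigD1 i0)//= addrC; congr (_ + _).
  by apply: eq_bigl => i; rewrite ltnS [in RHS]ltn_neqAle andbC.
have J C D : measurable C -> measurable D -> P (S m @^-1` C `&` V @^-1` D `&` E m.+1 B)
  = (gauss (Num.sqrt (\sum_(i < n | (i < m)%N) (a i * s i) ^+ 2)) C *
     gauss (a i0 * s i0) D * P (E m.+1 B))%E.
  move=> mC mD.
  (* The constraint on the next term [V] becomes one more constraint on a variable not yet summed,
     so that the induction hypothesis yields the product formula for the pair. *)
  pose B' i := if i == i0 then (fun x => a i0 * x) @^-1` D else B i.
  have maD : measurable ((fun x => a i0 * x) @^-1` D).
    exact: measurable_preimageT (mulrl_measurable _) mD.
  have mB' i : measurable (B' i) by rewrite /B'; case: ifP.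
  rewrite (_ : _ `&` _ = S m @^-1` C `&` E m B'); last first.
    apply/seteqP; split => w /=.
      move=> [[Cw Dw] Ew]; split => // i im; rewrite /B'; case: eqP => [->//|/eqP ii0].
      by apply: Ew; rewrite ltn_neqAle im andbT eq_sym.
    move=> [Cw Ew]; split; first split => //.
      by have := Ew i0 (leqnn _); rewrite /B' eqxx.
    move=> i im; have := Ew i (ltnW im); rewrite /B'; case: eqP => // ii0.
    by move: im; rewrite ii0 ltnn.
  rewrite (IH (ltnW mn))// !PE// [X in (_ * X)%E = _](bigD1 i0)//= muleA; congr (_ * _ * _)%E.
    rewrite /B' eqxx lawW// !gaussE; congr (normal_prob 0 1 _).
    by apply/seteqP; split => u /=; rewrite mulrA.
  apply: eq_big => i; first by rewrite [in RHS]ltn_neqAle andbC eq_sym.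
  by move=> /andP[_ /negPf ii0]; rewrite /B' ii0.
rewrite SE (_ : _ @^-1` A = (fun w => (S m w, V w)) @^-1` [set p | A (p.1 + p.2)])//.
rewrite (joint_law_on_event (mS m) mV (mE _ _ mB) J); last first.
  have mD : measurable_fun setT (fun p : R * R => p.1 + p.2) by exact: measurable_funD.
  exact: measurable_preimageT mD mA.
have Hs : \sum_(i < n | (i < m.+1)%N) (a i * s i) ^+ 2 =
    \sum_(i < n | (i < m)%N) (a i * s i) ^+ 2 + (a i0 * s i0) ^+ 2.
  rewrite (bigD1 i0)//= addrC; congr (_ + _).
  by apply: eq_bigl => i; rewrite ltnS [in RHS]ltn_neqAle andbC.
by rewrite (gauss_convolution _ _ mA) sqr_sqrtr ?Hs// sumr_ge0// => i _; exact: sqr_ge0.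
Qed.

(** * Tails and small balls of a normal variable *)

Lemma normal_prob_tail (R : realType) (x : R) : 0 <= x ->
  (normal_prob 0 1 [set u | (x <= u)%R] <= (expR (- x ^+ 2 / 2))%:E)%E.
Proof.
move=> x0.
have mA : measurable [set u : measurableTypeR R | (x <= u)%R].
  rewrite (_ : [set _ | _] = `[x, +oo[%classic)//.
  by apply/seteqP; split => u /=; rewrite in_itv/= andbT.
have mp (m : R) : measurable_fun (setT : set (measurableTypeR R)) (fun y => (normal_pdf m 1 y)%:E).
  by apply/measurable_EFinP; exact: measurable_normal_pdf.
(* For u >= x >= 0, u^2 >= x^2 + (u - x)^2, so the density is at most e^{-x^2/2} times the density
   centred at x, which has total mass 1. *)
apply: (@le_trans _ _ (\int[lebesgue_measure]_(u in [set u | (x <= u)%R])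
   ((expR (- x ^+ 2 / 2))%:E * (normal_pdf x 1 u)%:E))%E).
  apply: ge0_le_integral => //.
  - by move=> u _; rewrite lee_fin normal_pdf_ge0.
  - exact: measurable_funTS.
  - by apply: measurable_funTS; exact: measurable_funeM.
  move=> u /= xu; rewrite -EFinM lee_fin !normal_pdfE ?oner_neq0// mulrCA.
  rewrite ler_wpM2l ?normal_peak_ge0// /normal_fun -expRD ler_expR expr1n subr0.
  nra.
rewrite ge0_integralZl//; last 2 first.
- exact: measurable_funTS.
- by move=> u _; rewrite lee_fin normal_pdf_ge0.
rewrite -[leRHS]mule1 lee_pmul2l ?lte_fin ?expR_gt0//.
exact: (probability_le1 (normal_prob x 1)).
Qed.

Lemma gauss_tail (R : realType) (s s0 x : R) : 0 <= s <= s0 -> 0 < s0 -> 0 <= x ->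
  (gauss s [set y | (x <= y)%R] <= (expR (- x ^+ 2 / (2 * s0 ^+ 2)))%:E)%E.
Proof.
move=> /andP[s_ge0 ss0] s0_gt0 x0.
have H y : measurable [set u : measurableTypeR R | (y <= u)%R].
  rewrite (_ : [set _ | _] = `[y, +oo[%classic)//.
  by apply/seteqP; split => u /=; rewrite in_itv/= andbT.
have mpre : measurable ((fun u : measurableTypeR R => s * u) @^-1` [set y | x <= y]).
  exact: measurable_preimageT (mulrl_measurable s) (H x).
rewrite gaussE; have [xz|xz] := eqVneq x 0.
  by rewrite xz expr0n/= oppr0 mul0r expR0 probability_le1// -xz.
have {xz}x0 : 0 < x by rewrite lt_neqAle eq_sym xz.
have xs0 : 0 <= x / s0 by rewrite divr_ge0// ltW.
apply: (le_trans _ (le_trans (normal_prob_tail xs0) _)).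
  apply: le_measure; rewrite ?inE//.
  move=> u /= xsu; rewrite ler_pdivrMr//.
  have [u0|u0] := leP 0 u; first by rewrite (le_trans xsu)// mulrC ler_wpM2l.
  have : s * u <= 0 by rewrite mulr_ge0_le0// ltW.
  by move=> su; have := lt_le_trans x0 (le_trans xsu su); rewrite ltxx.
rewrite lee_fin ler_expR le_eqVlt; apply/orP; left; apply/eqP.
by field; rewrite gt_eqF.
Qed.

Lemma normal_peak1E (R : realType) : normal_peak (1 : R) = (Num.sqrt (2 * pi))^-1.
Proof. by rewrite /normal_peak expr1n mul1r mulr_natl. Qed.

Lemma normal_peak1_le (R : realType) : normal_peak (1 : R) <= 2^-1.
Proof.
have pi2 := pi_ge2 R.
have pi0 : 0 < 2 * pi :> R by rewrite mulr_gt0// pi_gt0.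
rewrite normal_peak1E lef_pV2 ?posrE ?sqrtr_gt0//.
rewrite -[leLHS]ger0_norm// -sqrtr_sqr ler_sqrt ?(ltW pi0)//.
by move: (pi : R) pi2 => p p2; nra.
Qed.

Lemma normal_peak1_ge (R : realType) : 4^-1 <= normal_peak (1 : R).
Proof.
have pi2 := @pihalf_lt2 R.
have pi0 : 0 < 2 * pi :> R by rewrite mulr_gt0// pi_gt0.
rewrite normal_peak1E lef_pV2 ?posrE ?sqrtr_gt0//.
rewrite -[leRHS]ger0_norm// -sqrtr_sqr ler_sqrt ?sqr_ge0//.
by move: (pi : R) pi2 => p p2; nra.
Qed.

(** The standard density is at most 1/2, and the rescaled interval has length 2 a / s. *)
Lemma gauss_small_ball (R : realType) (s a : R) : 0 < s -> 0 <= a ->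
  (gauss s [set y | (`|y| < a)%R] <= (a / s)%:E)%E.
Proof.
move=> s0 a0.
rewrite gaussE (_ : _ @^-1` _ = `](- (a / s)), (a / s)[%classic); last first.
  apply/seteqP; split => u /=; rewrite in_itv/= -ltr_norml normrM (gtr0_norm s0);
    by rewrite ltr_pdivlMr// mulrC.
have as0 : 0 <= a / s by rewrite divr_ge0// ltW.
apply: (@le_trans _ _ (\int[lebesgue_measure]_(u in `](- (a / s))%R, (a / s)%R[%classic) (2^-1)%R%:E)%E).
  apply: ge0_le_integral => //.
  - by move=> u _; rewrite lee_fin normal_pdf_ge0.
  - by apply/measurable_EFinP/measurable_funTS; exact: measurable_normal_pdf.
  move=> u _; rewrite lee_fin (le_trans _ (normal_peak1_le R))//.
  by rewrite normal_pdf_ub// oner_neq0.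
rewrite integral_cst//= lebesgue_measure_itv/= lte_fin.
case: ifP => _; last by rewrite mule0 lee_fin.
by rewrite -EFinD -EFinM lee_fin; move: (a / s) as0 => q q0; lra.
Qed.

(** Only the mass of [x, x + 1] is kept, where the density is at least its value at x + 1. *)
Lemma gauss_lower_tail (R : realType) (s x : R) : 0 < s -> 0 <= x ->
  ((4^-1 * expR (- (x + 1) ^+ 2 / 2))%:E <= gauss s [set y | (s * x <= y)%R])%E.
Proof.
move=> s0 x0; rewrite gaussE (_ : _ @^-1` _ = `[x, +oo[%classic); last first.
  by apply/seteqP; split => u /=; rewrite in_itv/= andbT ler_pM2l.
apply: (@le_trans _ _ (normal_prob 0 1 `[x, x + 1]%classic)); last first.
  by apply: le_measure; rewrite ?inE// => u /=; rewrite !in_itv/= => /andP[->].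
apply: (@le_trans _ _ (\int[lebesgue_measure]_(u in `[x, (x + 1)%R]%classic)
   (4^-1 * expR (- (x + 1) ^+ 2 / 2))%R%:E)%E).
  rewrite integral_cst//= lebesgue_measure_itv/= lte_fin ltrDl ltr01.
  by rewrite -EFinD -EFinM lee_fin addrAC subrr add0r mulr1.
apply: ge0_le_integral => //.
- by apply/measurable_EFinP/measurable_funTS; exact: measurable_normal_pdf.
move=> u /=; rewrite in_itv/= => /andP[xu ux1].
rewrite lee_fin normal_pdfE ?oner_neq0// ler_pM ?expR_ge0 ?normal_peak1_ge//.
by rewrite /normal_fun ler_expR expr1n subr0; nra.
Qed.

(** * Measurability of the log-likelihood ratio *)

Definition signed (R : realType) (d n : nat) (X : n.-tuple (d.-tuple R))
    (Y : n.-tuple R) (i : 'I_n) : 'rV[R]_d :=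
  \row_j (tnth Y i * tnth (tnth X i) j).

Lemma dot_signed (R : realType) (d n : nat) (X : n.-tuple (d.-tuple R))
    (Y : n.-tuple R) (i : 'I_n) (theta : 'rV[R]_d) :
  dot (signed X Y i) theta = tnth Y i * inner (tnth X i) theta.
Proof. by rewrite mulr_sumr; apply: eq_bigr => j _; rewrite mxE mulrA. Qed.

(** Removes [ln] and [sup] once and for all. This is legitimate because the likelihoods lie in
    [0, 1] and the one at 0 is 2^{-n}, so that the supremum is finite and positive. *)
Lemma log_likelihood_ratio_le (R : realType) (d n : nat)
    (X : n.-tuple (d.-tuple R)) (Y : n.-tuple R) (v : R) :
  log_likelihood_ratio 0 X Y <= v <->
  forall theta, lratio (signed X Y) theta <= expR v.
Proof.
have LE theta : lratio (signed X Y) theta = 2 ^+ n * likelihood X Y theta.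
  rewrite /lratio /likelihood; under eq_bigr do rewrite dot_signed.
  by rewrite big_split/= prodr_const card_ord.
have in0 i : inner (tnth X i) (0 : 'rV[R]_d) = 0.
  by rewrite /inner big1// => j _; rewrite mxE mulr0.
have p2 : 0 < 2 ^+ n :> R by rewrite exprn_gt0.
have L0 : likelihood X Y (0 : 'rV[R]_d) = (2 ^+ n)^-1.
  rewrite /likelihood; under eq_bigr do rewrite in0 mulr0.
  rewrite prodr_const card_ord -exprVn /sigmoid oppr0 expR0 div1r.
  by rewrite (_ : 1 + 1 = 2).
have sig1 (t : R) : 0 <= sigmoid t <= 1.
  rewrite ltW ?sigmoid_gt0//= /sigmoid ler_pdivrMr ?mul1r ?lerDl ?expR_ge0//.
have hub : has_ubound (range (likelihood X Y)).
  by exists 1 => _ [th _ <-]; apply: prodr_ile1 => i _; exact: sig1.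
have sup0 : 0 < sup (range (likelihood X Y)).
  apply: (@lt_le_trans _ _ (likelihood X Y 0)); first by rewrite L0 invr_gt0.
  by apply: (ub_le_sup hub); exists 0.
rewrite /log_likelihood_ratio L0 invrK.
have -> : (ln (sup (range (likelihood X Y)) * 2 ^+ n) <= v) =
    (sup (range (likelihood X Y)) <= expR v / 2 ^+ n).
  rewrite ler_pdivlMr// -[RHS]ler_ln ?posrE ?mulr_gt0 ?expR_gt0//.
  by rewrite expRK.
split=> H.
  move=> th; rewrite LE mulrC -ler_pdivlMr//; apply: le_trans H.
  by apply: (ub_le_sup hub); exists th.
apply: ge_sup; first by exists (likelihood X Y 0), 0.
by move=> _ [th _ <-]; rewrite ler_pdivlMr// mulrC -LE.
Qed.

Lemma sigmoid_continuous (R : realType) : continuous (@sigmoid R).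
Proof.
move=> t; apply: cvgM; first exact: cvg_cst.
apply: cvgV; first by rewrite gt_eqF// addr_gt0// expR_gt0.
apply: cvgD; first exact: cvg_cst.
apply: (cvg_comp (fun x : R => - x) expR); last exact: continuous_expR.
by apply: cvgN; exact: cvg_id.
Qed.

Lemma measurable_sigmoid (R : realType) : measurable_fun setT (@sigmoid R).
Proof. by apply: continuous_measurable_fun; exact: sigmoid_continuous. Qed.

(** By continuity in theta along the approximations floor (theta_j (m+1)) / (m+1). Thus the event
    that the ratio is bounded for all theta becomes a countable intersection, hence measurable. *)
Lemma lratio_le_rat (R : realType) (d n : nat) (z : 'I_n -> 'rV[R]_d) (c : R) :
  (forall q : 'rV[rat]_d, lratio z (map_mx ratr q) <= c) ->
  forall theta, lratio z theta <= c.
Proof.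
move=> H theta.
pose q (m : nat) : 'rV[rat]_d :=
  \row_j ((Num.floor (theta ord0 j * m.+1%:R))%:~R / m.+1%:R).
have cq j : (map_mx ratr (q m) : 'rV[R]_d) ord0 j @[m --> \oo] --> theta ord0 j.
  apply: (@squeeze_cvgr _ _ _ _ (fun m => theta ord0 j - m.+1%:R^-1)
    (fun=> theta ord0 j)).
  - apply: nearW => m; rewrite !mxE fmorph_div/= ratr_int ratr_nat.
    have /andP[f1 f2] := floor_itv (theta ord0 j * m.+1%:R).
    rewrite ler_pdivrMr// ler_pdivlMr// mulrBl mulVf// f1 andbT.
    by move: f2; rewrite intrD; lra.
  - rewrite -[X in _ --> X]subr0; apply: cvgB; first exact: cvg_cst.
    exact: cvg_harmonic.
  - exact: cvg_cst.
have cl : lratio z (map_mx ratr (q m)) @[m --> \oo] --> lratio z theta.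
  apply: cvg_big => [|i _]; first exact: mul_continuous.
  apply: cvgM; first exact: cvg_cst.
  apply: (cvg_comp _ (@sigmoid R)); last exact: sigmoid_continuous.
  apply: cvg_big => [|j _]; first exact: add_continuous.
  by apply: cvgM; [exact: cvg_cst|exact: cq].
by apply: (cvgr_to_le cl); apply: nearW => m; exact: H.
Qed.

Section Measurability.
Context (R : realType) (disp : measure_display) (T : measurableType disp).
Variables (d n : nat) (x : 'I_n -> T -> d.-tuple R) (y : 'I_n -> T -> R).
Hypothesis mx : forall i, measurable_fun setT (x i).
Hypothesis my : forall i, measurable_fun setT (y i).

Lemma measurable_inner (theta : 'rV[R]_d) :
  measurable_fun setT (fun t : d.-tuple R => inner t theta).
Proof.
by apply: measurable_sum => j; apply: measurable_funM => //; exact: measurable_tnth.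
Qed.

Lemma measurable_log_likelihood_ratio_le (v : R) :
  measurable [set w | log_likelihood_ratio 0 [tuple x i w | i < n]
                        [tuple y i w | i < n] <= v].
Proof.
pose z w := signed [tuple x i w | i < n] [tuple y i w | i < n].
pose F (q : 'rV[rat]_d) := [set w | (lratio (z w) (map_mx ratr q) <= expR v)%R].
have mF q : measurable (F q).
  have ml : measurable_fun setT (fun w => lratio (z w) (map_mx ratr q)).
    apply: measurable_prod => i _; apply: measurable_funM => //.
    apply: measurableT_comp; first exact: measurable_sigmoid.
    rewrite (_ : (fun w => _) = fun w => y i w * inner (x i w) (map_mx ratr q)).
      by apply: measurable_funM => //; exact: (measurableT_comp (measurable_inner _) (mx i)).
    by apply/funext => w; rewrite dot_signed !tnth_mktuple.
  rewrite (_ : F q = (fun w => lratio (z w) (map_mx ratr q)) @^-1` `]-oo, expR v]%classic).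
    exact: measurable_preimageT.
  by apply/seteqP; split => w; rewrite /F/= in_itv.
rewrite (_ : mkset _ = ~` \bigcup_q (~` F q)); last first.
  rewrite setC_bigcup; apply/seteqP; split => w /=.
    by move=> /log_likelihood_ratio_le H q _; rewrite setCK; exact: H.
  move=> H; apply/log_likelihood_ratio_le; apply: lratio_le_rat => q.
  by have := H q I; rewrite setCK.
apply: measurableC; apply: countable_bigcupT_measurable.
  exact: countableP.
by move=> q; exact: measurableC.
Qed.

End Measurability.

(** * Laws of linear forms of the signed design *)

Lemma union_bound (R : realType) (disp : measure_display)
    (T : measurableType disp) (P : probability T R) (I : eqType) (s : seq I)
    (F : I -> set T) (p : R) :
  (forall i, i \in s -> measurable (F i)) ->
  (forall i, i \in s -> (P (F i) <= p%:E)%E) ->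
  measurable [set w | exists2 i, i \in s & F i w] /\
  (P [set w | exists2 i, i \in s & F i w] <= ((size s)%:R * p)%:E)%E.
Proof.
elim: s => [_ _|i s IH mF PF].
  rewrite (_ : mkset _ = set0); last by apply/seteqP; split => // w [].
  by rewrite measure0 mul0r lexx; split.
have [ms Ps] : _ := IH (fun j js => mF j (mem_behead (s := i :: s) js))
  (fun j js => PF j (mem_behead (s := i :: s) js)).
have mFi := mF i (mem_head i s).
rewrite (_ : mkset _ = F i `|` [set w | exists2 j, j \in s & F j w]); last first.
  apply/seteqP; split => w /= => [[j]|[Fi|[j js Fj]]].
  - by rewrite in_cons => /orP[/eqP -> Fi|js Fj]; [left|right; exists j].
  - by exists i => //; rewrite mem_head.
  - by exists j => //; rewrite in_cons js orbT.
split; first exact: measurableU.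
apply: (le_trans (measureU2 P mFi ms)).
by rewrite /= -natr1 mulrDl mul1r addrC EFinD leeD// PF// mem_head.
Qed.

Section SignedDesign.
Context (R : realType) (disp : measure_display) (T : measurableType disp).
Variables (P : probability T R) (d n : nat).
Variables (X : 'I_n -> {RV P >-> d.-tuple R}) (Y : 'I_n -> {RV P >-> R}).
Hypothesis model : null_logistic_model X Y.

Definition design (w : T) : 'I_n -> 'rV[R]_d :=
  signed [tuple X i w | i < n] [tuple Y i w | i < n].

Lemma dot_design w i u : dot (design w i) u = Y i w * inner (X i w) u.
Proof. by rewrite dot_signed !tnth_mktuple. Qed.

Let mX i : measurable_fun setT (X i). Proof. exact: measurable_funPT. Qed.
Let mY i : measurable_fun setT (Y i). Proof. exact: measurable_funPT. Qed.

Let mXu u i : measurable_fun setT (fun w => inner (X i w) u).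
Proof. exact: (measurableT_comp (measurable_inner _) (mX i)). Qed.

Lemma inner_law (u : 'rV[R]_d) (i : 'I_n) (A : set R) : measurable A ->
  P ((fun w => inner (X i w) u) @^-1` A) = gauss (nrm u) A.
Proof.
case: model => _ /(_ i) [indX lawX] _ _ _ mA.
have := @gauss_linear_combination _ _ _ P d (fun j w => tnth (X i w) j)
  (fun j => u ord0 j) (fun=> 1) A.
have -> : \sum_(j < d) (u ord0 j * 1) ^+ 2 = dot u u.
  by apply: eq_bigr => j _; rewrite mulr1 expr2.
move=> <- //.
- congr (P _); apply/seteqP; split => w /=; rewrite /inner;
  by under eq_bigr do rewrite mulrC.
- by move=> j; exact: (measurableT_comp (measurable_tnth j) (mX i)).
- move=> j B mB; rewrite lawX// gaussE; congr (normal_prob 0 1 _).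
  by apply/seteqP; split => x /=; rewrite mul1r.
Qed.

Lemma inner_independent (u : 'rV[R]_d) :
  mutually_independent P (fun i w => inner (X i w) u).
Proof.
case: model => indX _ _ _ _ J B mB.
apply: (indX J (fun i => (fun t => inner t u) @^-1` B i)) => i.
exact: measurable_preimageT (measurable_inner u) (mB i).
Qed.

(** [uniform_sign] prescribes two probabilities only; as they add up to 1, other values of the
    labels are confined to a null set. *)
Lemma signs_ae : P [set w | forall i, Y i w = 1 \/ Y i w = -1] = 1%E.
Proof.
have N1 : (1 : R) <> -1 by lra.
case: model => _ _ _ lawY _.
have mG i a : measurable (Y i @^-1` [set a]).
  by apply: measurable_preimageT; [exact: mY|exact: measurable_set1].
pose F i := ~` (Y i @^-1` [set 1] `|` Y i @^-1` [set -1]).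
have mF i : measurable (F i) by apply: measurableC; apply: measurableU.
have PF i : P (F i) = 0%E.
  have [Y1 YN1] := lawY i.
  have disj : Y i @^-1` [set 1] `&` Y i @^-1` [set -1] = set0.
    by apply/seteqP; split => w //= [h1 h2]; exact: N1 (etrans (esym h1) h2).
  pose G := Y i @^-1` [set 1] `|` Y i @^-1` [set -1].
  have PU : P G = ((2^-1 : R)%:E + (2^-1 : R)%:E)%E.
    by rewrite /G measureU//; exact: (congr2 adde Y1 YN1).
  have -> : P (F i) = (1 - P G)%E by apply: probability_setC; exact: measurableU.
  rewrite PU -EFinD; apply: (congr1 EFin (_ : 1 - (2^-1 + 2^-1) = 0 :> R)).
  by field.
have [mU PU] := @union_bound _ _ _ P _ (enum 'I_n) F 0 (fun i _ => mF i)
  (fun i _ => eq_ind_r (fun x => (x <= 0)%E) (lexx 0%E) (PF i)).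
rewrite (_ : mkset _ = ~` [set w | exists2 i, i \in enum 'I_n & F i w]); last first.
  apply/seteqP; split => w /= => [H [i _]|H i]; first by rewrite /F /=; apply; exact: H.
  apply: contrapT => h; apply: H; exists i; first by rewrite mem_enum.
  by move=> [h1|h1]; apply: h; [left|right].
rewrite probability_setC// (_ : P _ = 0%E) ?sube0//.
by apply/eqP; rewrite eq_le measure_ge0// andbT; move: PU; rewrite mulr0.
Qed.

Definition sign_event (e : {ffun 'I_n -> bool}) : set T :=
  [set w | forall i, Y i w = (-1) ^+ (e i)].

(* On each sign pattern of [Y], the form is a fixed linear combination of the
   independent variables <X_i, u>, whose law does not depend on the pattern. *)
Lemma design_law (b : 'rV[R]_n) (u : 'rV[R]_d) (A : set R) : measurable A ->
  P [set w | A (dot (comb (design w) b) u)] = gauss (nrm b * nrm u) A.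
Proof.
move=> mA; set E := mkset _.
have EE : E = (fun w => \sum_i b ord0 i * (Y i w * inner (X i w) u)) @^-1` A.
  rewrite /E; congr (_ @^-1` A); apply/funext => w; rewrite dot_comb.
  by apply: eq_bigr => i _; rewrite mxE dot_design.
have mE : measurable E.
  rewrite EE; apply: measurable_preimageT => //; apply: measurable_sum => i.
  apply: measurable_funM => //; apply: measurable_funM; [exact: mY|exact: mXu].
have mS e : measurable (sign_event e).
  rewrite (_ : sign_event e = \bigcap_(i in [set: 'I_n]) (Y i @^-1` [set (-1) ^+ (e i)])).
    apply: fin_bigcap_measurable; first exact: finite_finset.
    by move=> i _; apply: measurable_preimageT; [exact: mY|exact: measurable_set1].
  by apply/seteqP; split => w H i; [move=> _; exact: H|exact: (H i I)].
have PS e : P (E `&` sign_event e) = (gauss (nrm b * nrm u) A * P (sign_event e))%E.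
  case: model => _ _ _ _ ind.
  pose a i := b ord0 i * (-1) ^+ (e i).
  pose AX := [set t : n.-tuple (d.-tuple R) | A (\sum_i a i * inner (tnth t i) u)].
  pose BY := [set t : n.-tuple R | forall i, tnth t i = (-1) ^+ (e i)].
  have mAX : measurable AX.
    apply: (@measurable_preimageT _ _ _ _
      (fun t : n.-tuple (d.-tuple R) => \sum_i a i * inner (tnth t i) u)) => //.
    apply: measurable_sum => i; apply: measurable_funM => //.
    exact: (measurableT_comp (measurable_inner u) (measurable_tnth i)).
  have mBY : measurable BY.
    rewrite (_ : BY = \bigcap_(i in [set: 'I_n])
        ((fun t : n.-tuple R => tnth t i) @^-1` [set (-1) ^+ (e i)])).
      apply: fin_bigcap_measurable; first exact: finite_finset.
      by move=> i _; apply: measurable_preimageT; [exact: measurable_tnth|exact: measurable_set1].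
    by apply/seteqP; split => w H i; [move=> _; exact: H|exact: (H i I)].
  have H := ind AX BY mAX mBY.
  have SE : sign_event e = (fun w => [tuple Y i w | i < n]) @^-1` BY.
    by apply/seteqP; split => w /= H' i; [rewrite tnth_mktuple; exact: H'|
      have := H' i; rewrite tnth_mktuple].
  have AE : (fun w => [tuple X i w | i < n]) @^-1` AX = [set w | A (\sum_i a i * inner (X i w) u)].
    rewrite /AX; apply: (congr1 (fun f => f @^-1` A)); apply/funext => w.
    by apply: eq_bigr => i _; rewrite tnth_mktuple.
  rewrite (_ : E `&` _ = (fun w => [tuple X i w | i < n]) @^-1` AX `&`
    (fun w => [tuple Y i w | i < n]) @^-1` BY); last first.
    rewrite AE -SE EE; apply/seteqP; split => w /= [EA Sw]; split => //; move: EA;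
    rewrite (_ : \sum_i b ord0 i * _ = \sum_i a i * inner (X i w) u)//;
    by apply: eq_bigr => i _; rewrite Sw mulrA.
  rewrite H -SE AE; congr (_ * _)%E.
  have := @gauss_linear_combination _ _ _ P n (fun i w => inner (X i w) u) a
    (fun=> nrm u) A (mXu u) (inner_independent u) (fun i B => @inner_law u i B) mA.
  move=> ->; congr (gauss _ A).
  have -> : \sum_(i < n) (a i * nrm u) ^+ 2 = (nrm b * nrm u) ^+ 2.
    rewrite exprMn sqr_nrm mulr_suml; apply: eq_bigr => i _.
    by rewrite exprMn exprMn sqrr_sign mulr1 expr2.
  by rewrite sqrtr_sqr ger0_norm// mulr_ge0 ?nrm_ge0.
pose D := [set: {ffun 'I_n -> bool}].
have fD : finite_set D by exact: finite_finset.
have tS : trivIset D sign_event.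
  move=> e e' _ _ [w [we we']]; apply/ffunP => i.
  have := we i; rewrite we' => /eqP; rewrite (inj_eq (@signr_inj R)) => /eqP.
  by [].
have SU : \bigcup_(e in D) sign_event e = [set w | forall i, Y i w = 1 \/ Y i w = -1].
  apply/seteqP; split => w.
    by move=> [e _ ew] i; rewrite ew; case: (e i); rewrite ?expr1 ?expr0; [right|left].
  move=> H; exists [ffun i => Y i w != 1] => // i; rewrite ffunE.
  by case: (H i) => ->; rewrite ?eqxx ?expr0//; case: eqP => //= ->.
have mSU : measurable (\bigcup_(e in D) sign_event e) by apply: fin_bigcup_measurable.
have PSU : P (\bigcup_(e in D) sign_event e) = 1%E by rewrite SU signs_ae.
(* Outside the sign patterns lies only a null set, so [E] can be decomposed along them. *)
have -> : P E = P (E `&` \bigcup_(e in D) sign_event e).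
  apply/eqP; rewrite eq_le; apply/andP; split; last first.
    by apply: le_measure; rewrite ?inE//; exact: measurableI.
  have PC : P (~` \bigcup_(e in D) sign_event e) = 0%E.
    by rewrite probability_setC// PSU subee.
  have : (P (E `&` \bigcup_(e in D) sign_event e
      `|` ~` (\bigcup_(e in D) sign_event e)) <=
    P (E `&` \bigcup_(e in D) sign_event e) +
    P (~` (\bigcup_(e in D) sign_event e)))%E.
    exact: (measureU2 P (measurableI _ _ mE mSU) (measurableC mSU)).
  rewrite PC adde0; apply: le_trans.
  apply: le_measure; rewrite ?inE//; first by apply: measurableU; [exact: measurableI|exact: measurableC].
  by move=> w Ew; have [h|h] := pselect ((\bigcup_(e in D) sign_event e) w); [left|right].
rewrite setI_bigcupr measure_fin_bigcup//; last 2 first.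
- by move=> e e' De De' [w [[_ h] [_ h']]]; apply: tS => //; exists w.
- by move=> e _; exact: measurableI.
rewrite (eq_fsbigr (fun e => (gauss (nrm b * nrm u) A * P (sign_event e))%E)); last by move=> e _; exact: PS.
rewrite -ge0_mule_fsumr; last by move=> e; exact: measure_ge0.
have <- : P (\bigcup_(e in D) sign_event e) = (\sum_(e \in D) P (sign_event e))%R.
  exact: (measure_fin_bigcup P fD tS (fun e _ => mS e)).
by rewrite PSU mule1.
Qed.

End SignedDesign.

(** * High-probability events *)

Lemma prode_le_expr (R : realType) (I : finType) (J : {set I}) (F : I -> \bar R)
    (c : R) : (forall i, 0 <= F i <= c%:E)%E ->
  (\prod_(i in J) F i <= (c ^+ #|J|)%:E)%E.
Proof.
move=> Fc; rewrite -prodr_const.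
pose K (x : \bar R) (y : R) := (0 <= x <= y%:E)%E.
suff /andP[] : K (\prod_(i in J) F i)%E (\prod_(i in J) c) by [].
apply: (big_ind2 K) => [|x1 x2 y1 y2 /andP[h1 h2] /andP[h3 h4]|i _].
- by rewrite /K lexx lee_fin ler01.
- by rewrite /K mule_ge0//= EFinM lee_pmul.
- exact: Fc.
Qed.

(** Markov's inequality for the number of events that occur, whose mean is at most m p, at the level
    m / 2. The events may be dependent. *)
Lemma half_count_markov (R : realType) (disp : measure_display)
    (T : measurableType disp) (P : probability T R) (m : nat) (F : 'I_m -> set T)
    (p : R) : (0 < m)%N -> (forall j, measurable (F j)) ->
  (forall j, (P (F j) <= p%:E)%E) ->
  measurable [set w | m%:R <= 2 * \sum_j (\1_(F j) w : R)] /\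
  (P [set w | (m%:R <= 2 * \sum_j (\1_(F j) w : R))%R] <= (2 * p)%:E)%E.
Proof.
move=> m0 mF PF; set E := mkset _.
have mc : measurable_fun setT (fun w => 2 * \sum_j (\1_(F j) w : R)).
  by apply: measurable_funM => //; apply: measurable_sum => j; exact: measurable_indic.
have mE : measurable E.
  rewrite (_ : E = (fun w => 2 * \sum_j (\1_(F j) w : R)) @^-1` `[m%:R, +oo[%classic).
    exact: measurable_preimageT.
  by apply/seteqP; split => w; rewrite /E/= in_itv/= andbT.
split=> //.
have mp : 0 < m%:R :> R by rewrite ltr0n.
have c0 w : 0 <= 2 * \sum_j (\1_(F j) w : R).
  by rewrite mulr_ge0// sumr_ge0// => j _; rewrite indicE.
have mce : measurable_fun setT (fun w => (2 * \sum_j (\1_(F j) w : R))%:E).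
  exact/measurable_EFinP.
rewrite -(@lee_pmul2l _ m%:R%:E) ?lte_fin//.
rewrite -integral_cst//.
apply: (@le_trans _ _ (\int[P]_(w in E) (2 * \sum_j (\1_(F j) w : R))%:E)%E).
  apply: ge0_le_integral => //; first by move=> w _; rewrite lee_fin.
  exact: measurable_funTS.
apply: (@le_trans _ _ (\int[P]_w (2 * \sum_j (\1_(F j) w : R))%:E)%E).
  by apply: ge0_subset_integral => //; move=> w _; rewrite lee_fin.
under eq_integral do rewrite EFinM -sumEFin.
rewrite ge0_integralZl//; last 2 first.
- by apply: emeasurable_sum => j; apply/measurable_EFinP; exact: measurable_indic.
- by move=> w _; apply: sume_ge0 => j _; rewrite lee_fin indicE.
rewrite ge0_integral_sum//; last first.
  by move=> j; apply/measurable_EFinP; exact: measurable_indic.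
rewrite -EFinM mulrCA EFinM lee_pmul2l//.
apply: (@le_trans _ _ (\sum_(j < m) p%:E)%E); last first.
  by rewrite sumEFin sumr_const card_ord mulr_natl.
by apply: lee_sum => j _; rewrite integral_indic// setIT; exact: PF.
Qed.

(* A constant with sup_u sum_i <z_i, u>^2 <= opK n outside an event of
   probability e^{-4n}; a definition keeps arithmetic tactics from unfolding
   the numeral. *)
Definition opK (R : realType) : R := 512.

Lemma opK_gt0 (R : realType) : 0 < opK R. Proof. by rewrite /opK; lra. Qed.

Lemma sqrt_opK_le (R : realType) : Num.sqrt (opK R) <= 23.
Proof.
have h : 0 <= 23 :> R by lra.
rewrite -(ger0_norm h) -sqrtr_sqr ler_sqrt ?sqr_ge0//.
by rewrite /opK; lra.
Qed.

Section Events.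
Context (R : realType) (disp : measure_display) (T : measurableType disp).
Variables (P : probability T R) (d n : nat).
Variables (X : 'I_n -> {RV P >-> d.-tuple R}) (Y : 'I_n -> {RV P >-> R}).
Hypothesis model : null_logistic_model X Y.
Hypotheses (d0 : (0 < d)%N) (dn : (d <= n)%N).

Notation z := (design X Y).

Let n0 : (0 < n)%N. Proof. exact: leq_trans d0 dn. Qed.
Let np : 0 < n%:R :> R. Proof. by rewrite ltr0n. Qed.

Lemma measurable_design_form (b : 'rV[R]_n) (u : 'rV[R]_d) :
  measurable_fun setT (fun w => dot (comb (z w) b) u).
Proof.
rewrite (_ : (fun w => _) = fun w => \sum_i b ord0 i * (Y i w * inner (X i w) u)).
  apply: measurable_sum => i; apply: measurable_funM => //; apply: measurable_funM.
    exact: measurable_funPT.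
  apply: measurableT_comp (measurable_inner u) _; exact: measurable_funPT.
by apply/funext => w; rewrite dot_comb; apply: eq_bigr => i _; rewrite mxE dot_design.
Qed.

Lemma design_tail (b : 'rV[R]_n) (u : 'rV[R]_d) (s x : R) :
  0 < s -> nrm b * nrm u <= s -> 0 <= x ->
  measurable [set w | x <= dot (comb (z w) b) u] /\
  (P [set w | (x <= dot (comb (z w) b) u)%R] <= (expR (- x ^+ 2 / (2 * s ^+ 2)))%:E)%E.
Proof.
move=> s0 bus x0; have mA : measurable [set y : R | x <= y].
  rewrite (_ : [set _ | _] = `[x, +oo[%classic)//.
  by apply/seteqP; split => u' /=; rewrite in_itv/= andbT.
split; first exact: measurable_preimageT (measurable_design_form b u) mA.
rewrite (design_law model b u mA); apply: gauss_tail => //.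
by rewrite bus andbT mulr_ge0 ?nrm_ge0.
Qed.

Lemma exists_half_net (k : nat) : (0 < k)%N -> exists s : seq 'rV[R]_k,
  [/\ (size s)%:R <= expR (6 * k%:R) :> R, forall v, v \in s -> nrm v <= 1 & half_net s].
Proof.
move=> k0; have [|s [s1 s2 s3]] := @unit_ball_net R k 2^-1 k0; first by rewrite invr_gt0.
exists s; split => //.
  by apply: (le_trans s1); rewrite ler_expR exprVn invrK mulrC; lra.
move=> v /s2 v1; rewrite -ler_sqr ?nnegrE ?nrm_ge0// sqr_nrm expr1n.
exact: v1.
Qed.

Lemma nrm_ones : nrm (const_mx 1 : 'rV[R]_n) = Num.sqrt n%:R.
Proof.
congr Num.sqrt; rewrite /dot; under eq_bigr do rewrite !mxE mulr1.
by rewrite sumr_const card_ord.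
Qed.

Lemma comb_ones w : comb (z w) (const_mx 1) = \sum_i z w i.
Proof. by apply: eq_bigr => i _; rewrite mxE scale1r. Qed.

(** The level M^2 = 32 n gives each bilinear form a tail e^{-16 n}; the two nets have at most e^{6n}
    e^{6d} <= e^{12 n} pairs, which leaves e^{-4n}. The factor 4 lost to the nets turns 32 into
    [opK] = 16 * 32. *)
Lemma operator_norm_event : exists B : set T,
  [/\ measurable B, (P B <= (expR (- (4 * n%:R)))%:E)%E &
    forall w, ~ B w -> forall u, nrm (app (z w) u) <= Num.sqrt (opK R * n%:R) * nrm u].
Proof.
have [sn [cn n1 hn]] := exists_half_net n0.
have [sd [cd d1 hd]] := exists_half_net d0.
pose M : R := Num.sqrt (32 * n%:R).
have M2 : M ^+ 2 = 32 * n%:R by rewrite sqr_sqrtr// mulr_ge0.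
pose I := [seq (b, v) | b <- sn, v <- sd].
pose F (p : 'rV[R]_n * 'rV[R]_d) := [set w | M <= dot (comb (z w) p.1) p.2].
have FP p : p \in I -> measurable (F p) /\ (P (F p) <= (expR (- (16 * n%:R)))%:E)%E.
  move=> /allpairsP[[b v] [/= bs vs ->]].
  have bv : nrm b * nrm v <= 1 by rewrite mulr_ile1 ?nrm_ge0 ?n1 ?d1.
  have [mF PF] := design_tail ltr01 bv (sqrtr_ge0 (32 * n%:R)).
  split=> //; apply: (le_trans PF); rewrite lee_fin ler_expR -/M M2 expr1n.
  by lra.
have [mU PU] := @union_bound _ _ _ P _ I F _ (fun p pI => (FP p pI).1) (fun p pI => (FP p pI).2).
exists [set w | exists2 p, p \in I & F p w]; split => //.
  apply: (le_trans PU); rewrite lee_fin size_allpairs natrM.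
  apply: (@le_trans _ _ (expR (6 * n%:R) * expR (6 * n%:R) * expR (- (16 * n%:R)))).
    rewrite ler_wpM2r ?expR_ge0// ler_pM// (le_trans cd)// ler_expR ler_pM2l//.
    by rewrite ler_nat.
  by rewrite -!expRD ler_expR; lra.
move=> w Bw u.
have -> : Num.sqrt (opK R * n%:R) = 4 * M.
  rewrite /M /opK -[4 in RHS]ger0_norm// -sqrtr_sqr -sqrtrM ?sqr_ge0//; congr Num.sqrt.
  by rewrite mulrA; congr (_ * _); ring.
apply: (nrm_app_le_nets hn hd (sqrtr_ge0 _)) => b v bs vs.
rewrite leNgt; apply/negP => h; apply: Bw; exists (b, v); last exact: ltW.
by apply/allpairsP; exists (b, v).
Qed.

(** The form <S, v> has variance at most n on the net, so the level M^2 = 2 n (6 d + t + 2) gives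
    the tail e^{-(6d + t + 2)}. The net consumes e^{6d} of it, and passing to |S|^2 costs a factor
    4. *)
Lemma score_event (t : R) : 0 <= t -> exists B : set T,
  [/\ measurable B, (P B <= (expR (- t - 2))%:E)%E &
    forall w, ~ B w -> dot (\sum_i z w i) (\sum_i z w i) <= 8 * n%:R * (6 * d%:R + t + 2)].
Proof.
move=> t0; have [sd [cd d1 hd]] := exists_half_net d0.
have c0 : 0 <= 2 * n%:R * (6 * d%:R + t + 2).
  by rewrite mulr_ge0 ?mulr_ge0// !addr_ge0// mulr_ge0.
pose M : R := Num.sqrt (2 * n%:R * (6 * d%:R + t + 2)).
have M2 : M ^+ 2 = 2 * n%:R * (6 * d%:R + t + 2) by rewrite sqr_sqrtr.
pose F (v : 'rV[R]_d) := [set w | M <= dot (comb (z w) (const_mx 1)) v].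
have sn0 : 0 < Num.sqrt n%:R :> R by rewrite sqrtr_gt0.
have FP v : v \in sd -> measurable (F v) /\ (P (F v) <= (expR (- (6 * d%:R + t + 2)))%:E)%E.
  move=> vs.
  have bv : nrm (const_mx 1 : 'rV[R]_n) * nrm v <= Num.sqrt n%:R.
    by rewrite nrm_ones ler_piMr ?sqrtr_ge0// d1.
  have [mF PF] := design_tail sn0 bv (sqrtr_ge0 (2 * n%:R * (6 * d%:R + t + 2))).
  split=> //; apply: (le_trans PF); rewrite lee_fin ler_expR -/M M2 sqr_sqrtr//.
  rewrite le_eqVlt; apply/orP; left; apply/eqP.
  by field; rewrite gt_eqF.
have [mU PU] := @union_bound _ _ _ P _ sd F _ (fun p pI => (FP p pI).1) (fun p pI => (FP p pI).2).
exists [set w | exists2 p, p \in sd & F p w]; split => //.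
  apply: (le_trans PU); rewrite lee_fin.
  apply: (@le_trans _ _ (expR (6 * d%:R) * expR (- (6 * d%:R + t + 2)))).
    by rewrite ler_wpM2r ?expR_ge0.
  by rewrite -expRD ler_expR; lra.
move=> w Bw.
have h : nrm (\sum_i z w i) <= 2 * M.
  apply: (nrm_le_net hd (sqrtr_ge0 _)) => v vs; rewrite -comb_ones.
  by rewrite leNgt; apply/negP => h; apply: Bw; exists v => //; exact: ltW.
rewrite -sqr_nrm (_ : 8 * _ * _ = (2 * M) ^+ 2); last by rewrite exprMn M2; ring.
by apply: lerXn2r h; rewrite nnegrE ?nrm_ge0// mulr_ge0// sqrtr_ge0.
Qed.

(** Since |v| >= 1/2, a row satisfies |<z_i, v>| < a with probability at most 2 a <= e^{-10}. If the
    conclusion fails, at least n / 2 rows do so at once: probability e^{-5n} for a given set of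
    rows, and there are 2^n <= e^n sets. *)
Lemma spread_event (a : R) (s : seq 'rV[R]_d) : 0 < a -> 2 * a <= expR (- 10) ->
  exists B : set T,
  [/\ measurable B, (P B <= ((size s)%:R * expR (- (4 * n%:R)))%:E)%E &
    forall w, ~ B w -> forall v, v \in s -> 1 / 4 <= dot v v ->
      (n <= 2 * #|[set i | (a <= `|dot (z w i) v|)%R]%SET|)%N].
Proof.
move=> a0 a10.
pose A := [set y : R | `|y| < a].
have mA : measurable A.
  rewrite (_ : A = `]-a, a[%classic)//.
  by apply/seteqP; split => y; rewrite /A/= in_itv/= -ltr_norml.
pose Q (p : 'rV[R]_d * {set 'I_n}) := (1 / 4 <= dot p.1 p.1)%R && (n <= 2 * #|p.2|)%N.
(* With [Q] inside the event, [F p] is empty for irrelevant pairs, and the union bound can run over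
   all of them. *)
pose F p := [set w | Q p /\ forall i, i \in p.2 -> A (inner (X i w) p.1)].
pose I := [seq (v, J) | v <- s, J <- enum (powerset [set: 'I_n])].
have mF p : measurable (F p).
  have [Qp|Qp] := boolP (Q p); last first.
    rewrite (_ : F p = set0)//; apply/seteqP; split => // w [].
    by rewrite (negbTE Qp).
  rewrite (_ : F p = \bigcap_(i in [set i | i \in p.2]) ((fun w => inner (X i w) p.1) @^-1` A)).
    apply: fin_bigcap_measurable; first exact: finite_finset.
    move=> i _; apply: measurable_preimageT mA.
    by apply: measurableT_comp (measurable_inner _) _; exact: measurable_funPT.
  by apply/seteqP; split => w; [move=> []|split].
have PF p : (P (F p) <= (expR (- (5 * n%:R)))%:E)%E.
  have [|Qp] := boolP (Q p); last first.
    rewrite (_ : F p = set0) ?measure0 ?lee_fin ?expR_ge0//.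
    by apply/seteqP; split => // w []; rewrite (negbTE Qp).
  move=> Qp; have /andP[v4 nJ] := Qp.
  have nv : 2^-1 <= nrm p.1.
    rewrite -ler_sqr ?nnegrE ?nrm_ge0// sqr_nrm; apply: le_trans v4; lra.
  have nv0 : 0 < nrm p.1 by apply: lt_le_trans nv; rewrite invr_gt0.
  have -> : P (F p) = (\prod_(i in p.2) P ((fun w => inner (X i w) p.1) @^-1` A))%E.
    rewrite -(inner_independent model p.1 p.2 (fun _ => mA)); congr (P _).
    by apply/seteqP; split => w; [move=> []|split].
  apply: (le_trans (prode_le_expr (c := expR (- 10)) p.2 _)).
    move=> i; rewrite measure_ge0/= ?(inner_law model _ _ mA).
    apply: (le_trans (gauss_small_ball nv0 (ltW a0))).
    rewrite lee_fin; apply: le_trans a10.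
    by rewrite ler_pdivrMr//; nra.
  rewrite lee_fin -expRM_natl ler_expR.
  by move: nJ; rewrite -(ler_nat R) natrM; lra.
have [mU PU] := @union_bound _ _ _ P _ I F _ (fun p _ => mF p) (fun p _ => PF p).
(* Independence across rows is available for the covariates X_i; where all labels are signs, |<z_i,
   v>| = |<X_i, v>|. *)
pose SG := [set w | forall i, Y i w = 1 \/ Y i w = -1].
have mSG : measurable SG.
  rewrite (_ : SG = \bigcap_(i in [set: 'I_n]) (Y i @^-1` [set 1] `|` Y i @^-1` [set -1])).
    apply: fin_bigcap_measurable; first exact: finite_finset.
    by move=> i _; apply: measurableU; apply: measurable_preimageT;
      [exact: measurable_funPT|exact: measurable_set1|exact: measurable_funPT|exact: measurable_set1].
  by apply/seteqP; split => w H i; [move=> _; exact: H|exact: (H i Logic.I)].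
have PSG : P (~` SG) = 0%E by rewrite probability_setC// (signs_ae model) subee.
exists ([set w | exists2 p, p \in I & F p w] `|` ~` SG); split.
- by apply: measurableU => //; exact: measurableC.
- have : (P ([set w | exists2 p, p \in I & F p w] `|` ~` SG) <=
      P [set w | exists2 p, p \in I & F p w] + P (~` SG))%E.
    exact: (measureU2 P mU (measurableC mSG)).
  rewrite PSG adde0 => /le_trans; apply; apply: (le_trans PU).
  rewrite lee_fin size_allpairs natrM -cardE card_powerset cardsT card_ord -mulrA.
  rewrite ler_wpM2l// natrX.
  apply: (@le_trans _ _ (expR n%:R * expR (- (5 * n%:R)))).
    rewrite ler_wpM2r ?expR_ge0// -[n%:R in leRHS]mulr1 expRM_natl.
    by apply: lerXn2r; rewrite ?nnegrE ?expR_ge0// expR1_ge2.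
  by rewrite -expRD ler_expR; lra.
move=> w Bw v vs v4.
have SGw : SG w by apply: contrapT => h; apply: Bw; right.
have absd i : `|dot (z w i) v| = `|inner (X i w) v|.
  by rewrite dot_design normrM; case: (SGw i) => ->; rewrite ?normrN normr1 mul1r.
rewrite leqNgt; apply/negP => h; apply: Bw; left.
pose J := (~: [set i | (a <= `|dot (z w i) v|)%R])%SET.
exists (v, J); first by apply/allpairsP; exists (v, J); rewrite mem_enum powersetT inE.
split=> [|i /=].
  rewrite /Q v4/= /J; move: h; have := cardsC [set i | (a <= `|dot (z w i) v|)%R]%SET.
  by rewrite card_ord; set x := #|_|; set y := #|_|; lia.
by rewrite /J !inE -ltNge /A/= absd.
Qed.

Lemma sqr_coordinate (x : 'rV[R]_d) j : x ord0 j ^+ 2 <= dot x x.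
Proof.
rewrite /dot (bigD1 j)//= -expr2 lerDl sumr_ge0// => i _.
by rewrite -expr2 sqr_ge0.
Qed.

Lemma dot_delta (x : 'rV[R]_d) j : dot x (delta_mx ord0 j) = x ord0 j.
Proof.
rewrite /dot (bigD1 j)//= mxE !eqxx mulr1 big1 ?addr0// => i ij.
by rewrite mxE (negbTE ij) andbF mulr0.
Qed.

Lemma score_coordinate_law j (A : set R) : measurable A ->
  P [set w | A ((\sum_i z w i) ord0 j)] = gauss (Num.sqrt n%:R) A.
Proof.
move=> mA; have := design_law model (const_mx 1) (delta_mx ord0 j) mA.
have -> : nrm (delta_mx ord0 j : 'rV[R]_d) = 1.
  by rewrite /nrm dot_delta mxE !eqxx sqrtr1.
rewrite nrm_ones mulr1 => <-; congr (P _); apply/seteqP; split => w /=;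
by rewrite dot_delta comb_ones.
Qed.

Lemma measurable_score_coordinate j :
  measurable_fun setT (fun w => (\sum_i z w i) ord0 j).
Proof.
have := measurable_design_form (const_mx 1) (delta_mx ord0 j).
by under eq_fun do rewrite dot_delta comb_ones.
Qed.

(** Each coordinate of S is N(0, n), hence below sqrt n / 16 in modulus with probability at most
    1/16. By Markov, outside an event of probability 1/8 more than half of the coordinates exceed
    this level, whence (d / 2) (n / 256). *)
Lemma score_spread_event : exists B : set T,
  [/\ measurable B, (P B <= (8^-1)%:E)%E &
    forall w, ~ B w -> n%:R * d%:R / 512 <= dot (\sum_i z w i) (\sum_i z w i)].
Proof.
pose c : R := Num.sqrt n%:R / 16.
have sn0 : 0 < Num.sqrt n%:R :> R by rewrite sqrtr_gt0.
have c0 : 0 <= c by rewrite divr_ge0// ltW.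
pose A := [set y : R | `|y| < c].
have mA : measurable A.
  rewrite (_ : A = `]-c, c[%classic)//.
  by apply/seteqP; split => y; rewrite /A/= in_itv/= -ltr_norml.
pose F j := [set w | A ((\sum_i z w i) ord0 j)].
have mF j : measurable (F j) by exact: measurable_preimageT (measurable_score_coordinate j) mA.
have PF j : (P (F j) <= (16^-1)%:E)%E.
  rewrite (score_coordinate_law j mA); apply: (le_trans (gauss_small_ball sn0 c0)).
  by rewrite lee_fin /c mulrAC divff ?mul1r// gt_eqF.
have [mE PE] := half_count_markov d0 mF PF.
exists [set w | d%:R <= 2 * \sum_j (\1_(F j) w : R)]; split => //.
  by apply: (le_trans PE); rewrite lee_fin; lra.
move=> w /negP; rewrite -ltNge => h.
have c2 : c ^+ 2 = n%:R / 256 by rewrite expr_div_n sqr_sqrtr//; congr (_ / _); ring.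
apply: (@le_trans _ _ (\sum_(j < d) (1 - (\1_(F j) w : R)) * c ^+ 2)).
  rewrite -mulr_suml sumrB sumr_const card_ord c2.
  have q0 : 0 < n%:R / 256 :> R by move: np; lra.
  have -> : n%:R * d%:R / 512 = d%:R / 2 * (n%:R / 256) :> R by field.
  rewrite ler_pM2r//; move: h; lra.
apply: ler_sum => j _; rewrite -expr2 indicE.
have [wF|wF] := boolP (w \in F j); first by rewrite subrr mul0r sqr_ge0.
rewrite subr0 mul1r -[leRHS]real_normK ?num_real// ler_sqr ?nnegrE//.
by rewrite leNgt; apply/negP => hh; move/negP: wF; apply; rewrite inE.
Qed.

Lemma score_tail_event (x : R) : 0 <= x -> exists G : set T,
  [/\ measurable G, ((4^-1 * expR (- (x + 1) ^+ 2 / 2))%:E <= P G)%E &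
    forall w, G w -> n%:R * x ^+ 2 <= dot (\sum_i z w i) (\sum_i z w i)].
Proof.
move=> x0; have sn0 : 0 < Num.sqrt n%:R :> R by rewrite sqrtr_gt0.
pose A := [set y : R | Num.sqrt n%:R * x <= y].
have mA : measurable A.
  rewrite (_ : A = `[Num.sqrt n%:R * x, +oo[%classic)//.
  by apply/seteqP; split => u /=; rewrite in_itv/= andbT.
exists [set w | A ((\sum_i z w i) ord0 (Ordinal d0))]; split.
- exact: measurable_preimageT (measurable_score_coordinate _) mA.
- by rewrite (score_coordinate_law _ mA); exact: gauss_lower_tail.
move=> w /= h; apply: le_trans (sqr_coordinate _ (Ordinal d0)).
have -> : n%:R * x ^+ 2 = (Num.sqrt n%:R * x) ^+ 2 by rewrite exprMn sqr_sqrtr.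
have h0 : 0 <= Num.sqrt n%:R * x by rewrite mulr_ge0// ltW.
have h1 : Num.sqrt n%:R * x <= (\sum_i z w i) ord0 (Ordinal d0) := h.
by rewrite ler_sqr ?nnegrE// (le_trans h0 h1).
Qed.

End Events.

(** * Quantile bounds *)

Lemma min_addr_le (R : realType) (x y w : R) : 0 <= y ->
  Num.min x (y + w) <= y + Num.min x w.
Proof.
by move=> y0; rewrite ge_min; have [h|h] := leP x w; apply/orP;
  [left|right]; lra.
Qed.

Lemma expRN4_le (R : realType) : expR (- 4) <= 16^-1 :> R.
Proof.
have E : expR 4 = expR 2 * expR 2 :> R by rewrite -expRD; congr expR; ring.
rewrite expRN lef_pV2 ?posrE ?expR_gt0// E.
by have := expR2_ge4 R; move: (expR 2) => e e4; nra.
Qed.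

Section Bounds.
Context (R : realType) (disp : measure_display) (T : measurableType disp).
Variables (P : probability T R) (d n : nat).
Variables (X : 'I_n -> {RV P >-> d.-tuple R}) (Y : 'I_n -> {RV P >-> R}).
Hypothesis model : null_logistic_model X Y.
Hypotheses (d0 : (0 < d)%N) (dn : (d <= n)%N).
Variable delta : R.
Hypotheses (delta0 : 0 < delta) (delta2 : delta <= 1 / 2).

Let n0 : (0 < n)%N. Proof. exact: leq_trans d0 dn. Qed.
Let np : 0 < n%:R :> R. Proof. by rewrite ltr0n. Qed.
Let d1 : 1 <= d%:R :> R. Proof. by rewrite ler1n. Qed.
Let n1 : 1 <= n%:R :> R. Proof. by rewrite ler1n. Qed.
Let dnR : d%:R <= n%:R :> R. Proof. by rewrite ler_nat. Qed.

Notation z := (design X Y).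
Notation t := (ln (1 / delta)).

Definition llr (w : T) : R :=
  log_likelihood_ratio 0 [tuple X i w | i < n] [tuple Y i w | i < n].

Lemma measurable_llr_le (v : R) : measurable [set w | llr w <= v].
Proof.
apply: measurable_log_likelihood_ratio_le => i; exact: measurable_funPT.
Qed.

Lemma expRN_ln_inv : expR (- t) = delta.
Proof. by rewrite expRN lnK ?posrE ?divr_gt0// div1r invrK. Qed.

Lemma ln_inv_ge0 : 0 <= t.
Proof.
rewrite ln_ge0// div1r invf_ge1//; apply: (le_trans delta2); lra.
Qed.

(** The three size conditions have separate roles: the first bounds the net by e^n, the second makes
    e^{-3n} <= delta^3, and the third brings |S| into the range required by [lratio_score_le]. *)
Lemma llr_upper (a : R) : 0 < a -> a <= 1 -> 2 * a <= expR (- 10) ->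
  ((a / 100) ^- 2 + 2) * d%:R <= n%:R -> t <= n%:R ->
  64 * (d%:R + t) <= (a ^+ 2 / 16 / 32) ^+ 2 * n%:R ->
  ((1 - delta)%:E <=
     P [set w | (llr w <= 4 * 64 / (a ^+ 2 / 16) * (d%:R + t))%R])%E.
Proof.
have D0 := delta0; have D2 := delta2; have N1 := n1; have D1 := d1; have DN := dnR.
have dd : delta * delta <= 1 / 4 by nra.
have ddd : delta * (delta * delta) <= delta / 4 by rewrite ler_pM2l//; lra.
have sum3 (x y w e : R) : x <= e / 4 -> y <= e / 4 -> w <= e / 4 -> 0 < e ->
  x + y + w <= e by lra.
move=> a0 a1 a10 H1 H2 H3; have t0 := ln_inv_ge0.
have [B1 [mB1 PB1 HB1]] := operator_norm_event model d0 dn.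
have [B2 [mB2 PB2 HB2]] := score_event model d0 dn t0.
have e0 : 0 < a / 100 by rewrite divr_gt0.
have [s [s1 s2 s3]] := unit_ball_net d0 e0.
have [B3 [mB3 PB3 HB3]] := spread_event model d0 dn s a0 a10.
have mB : measurable (B1 `|` B2 `|` B3) by do ?apply: measurableU.
have PB : (P (B1 `|` B2 `|` B3) <= delta%:E)%E.
  have h1 : (P (B1 `|` B2 `|` B3) <= P (B1 `|` B2) + P B3)%E.
    by apply: measureU2 => //; exact: measurableU.
  have h2 : (P (B1 `|` B2) <= P B1 + P B2)%E by exact: measureU2.
  apply: (le_trans h1); apply: (le_trans (leeD h2 (lexx _))).
  apply: (le_trans (leeD (leeD PB1 PB2) PB3)); rewrite -!EFinD lee_fin.
  (* As t <= n, e^{-4n} <= e^{-3t} = delta^3, and delta <= 1/2 gives delta^3 <= delta / 4. *)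
  have b1 : expR (- (4 * n%:R)) <= delta / 4.
    apply: (@le_trans _ _ (expR (- t + (- t + - t)))); first by rewrite ler_expR; lra.
    by rewrite expRD expRD expRN_ln_inv.
  have b2 : expR (- t - 2) <= delta / 4.
    rewrite expRD expRN_ln_inv ler_pM2l// expRN lef_pV2 ?posrE ?expR_gt0//.
    exact: expR2_ge4.
  have b3 : (size s)%:R * expR (- (4 * n%:R)) <= delta / 4.
    apply: (@le_trans _ _ (expR (n%:R) * expR (- (4 * n%:R)))).
      by rewrite ler_wpM2r ?expR_ge0// (le_trans s1)// ler_expR mulrC.
    rewrite -expRD; apply: (@le_trans _ _ (expR (- t + (- t + - t)))).
      by rewrite ler_expR; lra.
    by rewrite expRD expRD expRN_ln_inv.
  exact: sum3 b1 b2 b3 delta0.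
apply: (@le_trans _ _ (P (~` (B1 `|` B2 `|` B3)))).
  by rewrite probability_setC// EFinB leeB.
apply: le_measure; rewrite ?inE; [exact: measurableC|exact: measurable_llr_le|].
move=> w nB /=.
have nB1 : ~ B1 w by move=> h; apply: nB; left; left.
have nB2 : ~ B2 w by move=> h; apply: nB; left; right.
have nB3 : ~ B3 w by move=> h; apply: nB; right.
have S2 : dot (\sum_i z w i) (\sum_i z w i) <= 64 * (d%:R + t) * n%:R.
  apply: (le_trans (HB2 w nB2)).
  have : 8 * (6 * d%:R + t + 2) <= 64 * (d%:R + t) by lra.
  move=> h; rewrite mulrAC; apply: ler_wpM2r => //; exact: ltW.
have kp : 0 < a ^+ 2 / 16 by rewrite divr_gt0// exprn_gt0.
have Sn : nrm (\sum_i z w i) <= a ^+ 2 / 16 * n%:R / 32.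
  have h0 : 0 <= a ^+ 2 / 16 * n%:R / 32 by rewrite divr_ge0// mulr_ge0// ltW.
  rewrite -ler_sqr ?nnegrE ?nrm_ge0//.
  rewrite sqr_nrm; apply: (le_trans S2).
  have -> : (a ^+ 2 / 16 * n%:R / 32) ^+ 2 = (a ^+ 2 / 16 / 32) ^+ 2 * n%:R * n%:R.
    by move: (a ^+ 2 / 16) => k; field.
  by rewrite ler_wpM2r// ltW.
apply/log_likelihood_ratio_le => theta.
have a01 : 0 < a <= 1 by rewrite a0.
apply: (le_trans (lratio_score_le (opK_gt0 R) (HB1 w nB1) n0 (sqrt_opK_le R) a01 s3
  (HB3 w nB3) theta Sn)).
rewrite ler_expR; move: (a ^+ 2 / 16) kp => k k0.
rewrite ler_pdivrMr ?mulr_gt0//.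
have -> : 4 * 64 / k * (d%:R + t) * (k * n%:R) = 4 * (64 * (d%:R + t) * n%:R).
  by move: (t) => t'; field; rewrite gt_eqF.
by rewrite ler_pM2l.
Qed.

Lemma llr_le_score (v : R) w :
  (forall u, nrm (app (z w) u) <= Num.sqrt (opK R * n%:R) * nrm u) ->
  llr w <= v -> dot (\sum_i z w i) (\sum_i z w i) / (8 * opK R * n%:R) <= v.
Proof.
move=> op /log_likelihood_ratio_le H.
have [theta Hth] := lratio_score_ge (opK_gt0 R) op n0.
by rewrite -ler_expR; exact: le_trans Hth (H theta).
Qed.

Let k0 : 0 < (8 * opK R)^-1. Proof. by rewrite invr_gt0 mulr_gt0// opK_gt0. Qed.

(** For smaller [v], the event [llr w <= v] would lie in two exceptional sets of total probability
    at most 1/16 + 1/8, less than 1/2 <= 1 - delta. *)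
Lemma llr_lower_dim (v : R) : ((1 - delta)%:E <= P [set w | (llr w <= v)%R])%E ->
  (8 * opK R)^-1 * (d%:R / 512) <= v.
Proof.
move=> Hv; rewrite leNgt; apply/negP => vlt.
have D2 := delta2; have N1 := n1.
have [B1 [mB1 PB1 HB1]] := operator_norm_event model d0 dn.
have [B2 [mB2 PB2 HB2]] := score_spread_event model d0 dn.
have : (P [set w | (llr w <= v)%R] <= P (B1 `|` B2))%E.
  apply: le_measure; rewrite ?inE; [exact: measurable_llr_le|exact: measurableU|].
  move=> w /= Hw; have [b1|nb1] := pselect (B1 w); first by left.
  right; apply: contrapT => nb2.
  have := llr_le_score (HB1 w nb1) Hw; rewrite leNgt => /negP; apply.
  apply: (lt_le_trans vlt).
  rewrite [leRHS](_ : _ = (8 * opK R)^-1 * (dot (\sum_i z w i) (\sum_i z w i) / n%:R)); last first.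
    by rewrite invfM mulrCA.
  by rewrite ler_pM2l// ler_pdivlMr// mulrC mulrA; exact: HB2.
have h : (P (B1 `|` B2) <= P B1 + P B2)%E by exact: measureU2.
move=> /(le_trans Hv)/le_trans/(_ h)/le_trans/(_ (leeD PB1 PB2)).
rewrite -EFinD lee_fin.
have : expR (- (4 * n%:R)) <= expR (- 4) :> R by rewrite ler_expR; lra.
have := expRN4_le R; lra.
Qed.

(** At x = sqrt m / 2, (x + 1)^2 / 2 <= m / 4 + 1, so the first coordinate of S is large with
    probability at least e^{-3 - m/4}. For m >= 8 this is at least 4 e^{-m}, more than delta +
    e^{-4n} <= 2 e^{-m}. *)
Lemma llr_lower_tail (m v : R) : 8 <= m -> m <= n%:R -> m <= t ->
  ((1 - delta)%:E <= P [set w | (llr w <= v)%R])%E ->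
  (8 * opK R)^-1 * (m / 4) <= v.
Proof.
move=> m8 mn mt Hv; rewrite leNgt; apply/negP => vlt.
have m0 : 0 <= m by lra.
pose x := Num.sqrt m / 2.
have x0 : 0 <= x by rewrite divr_ge0// sqrtr_ge0.
have x2 : x ^+ 2 = m / 4 by rewrite expr_div_n sqr_sqrtr//; congr (_ / _); ring.
have [B1 [mB1 PB1 HB1]] := operator_norm_event model d0 dn.
have [G [mG PG HG]] := score_tail_event model d0 dn x0.
have : (P [set w | (llr w <= v)%R] <= P (B1 `|` ~` G))%E.
  apply: le_measure; rewrite ?inE; [exact: measurable_llr_le| |].
    by apply: measurableU => //; exact: measurableC.
  move=> w /= Hw; have [b1|nb1] := pselect (B1 w); first by left.
  right => Gw.
  have := llr_le_score (HB1 w nb1) Hw; rewrite leNgt => /negP; apply.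
  apply: (lt_le_trans vlt).
  rewrite [leRHS](_ : _ = (8 * opK R)^-1 * (dot (\sum_i z w i) (\sum_i z w i) / n%:R)); last first.
    by rewrite invfM mulrCA.
  by rewrite ler_pM2l// ler_pdivlMr// mulrC -x2; exact: HG.
have h : (P (B1 `|` ~` G) <= P B1 + P (~` G))%E.
  by apply: measureU2 => //; exact: measurableC.
have PG' : (P (~` G) <= (1 - 4^-1 * expR (- (x + 1) ^+ 2 / 2))%:E)%E.
  by rewrite probability_setC// EFinB leeB.
move=> /(le_trans Hv)/le_trans/(_ h)/le_trans/(_ (leeD PB1 PG')).
rewrite -EFinD lee_fin.
have e4 : expR (- (4 * n%:R)) <= expR (- m) by rewrite ler_expR; lra.
have ed : delta <= expR (- m) by rewrite -expRN_ln_inv ler_expR; lra.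
have eg : 4 * expR (- m) <= 4^-1 * expR (- (x + 1) ^+ 2 / 2).
  apply: (@le_trans _ _ (expR (- 2) * expR (- (m / 4) - 1))); last first.
    rewrite ler_pM ?expR_ge0//.
      by rewrite expRN lef_pV2 ?posrE ?expR_gt0// expR2_ge4.
    by rewrite ler_expR -x2; have := sqr_ge0 (x - 1); rewrite sqrrB sqrrD; lra.
  apply: (@le_trans _ _ (expR 2 * expR (- m))).
    by rewrite ler_pM2r ?expR_gt0// expR2_ge4.
  by rewrite -!expRD ler_expR; lra.
have := expR_gt0 (- m); lra.
Qed.

(** Every factor of the ratio is at most 2 <= e. *)
Lemma llr_le_n : P [set w | llr w <= n%:R] = 1%E.
Proof.
rewrite (_ : mkset _ = setT) ?probability_setT//; apply/seteqP; split => // w _ /=.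
apply/log_likelihood_ratio_le => theta.
rewrite -[n%:R]mulr1 expRM_natl -[n in leRHS]card_ord -prodr_const.
apply: ler_prod => i _; rewrite mulr_ge0 ?(ltW (sigmoid_gt0 _))//=.
apply: le_trans (expR1_ge2 R); rewrite ler_piMr// /sigmoid ler_pdivrMr ?mul1r ?lerDl ?expR_ge0//.
Qed.

End Bounds.

Theorem corollary3p2 (R : realType) :
  exists c C : R, 0 < c /\ c <= C /\
  forall (d n : nat), (1 <= d)%N -> (d <= n)%N ->
  forall (disp : measure_display) (T : measurableType disp)
    (P : probability T R)
    (X : 'I_n -> {RV P >-> d.-tuple R}) (Y : 'I_n -> {RV P >-> R}),
  null_logistic_model X Y ->
  forall delta : R, 0 < delta -> delta <= 1 / 2 ->
  let q := quantile P (1 - delta)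
             (fun w => log_likelihood_ratio 0 [tuple X i w | i < n]
                                              [tuple Y i w | i < n]) in
  c * Num.min n%:R (d%:R + ln (1 / delta)) <= q /\
  q <= C * Num.min n%:R (d%:R + ln (1 / delta)).
Proof.
(* The largest threshold that [spread_event] allows. *)
pose a : R := expR (- 10) / 2.
have a0 : 0 < a by rewrite divr_gt0// expR_gt0.
have e10 : expR (- 10) <= 1 :> R by rewrite -[leRHS]expR0 ler_expR; lra.
have a1 : a <= 1 by rewrite /a; lra.
have a10 : 2 * a <= expR (- 10) by rewrite /a; lra.
clearbody a.
pose k : R := (8 * opK R)^-1.
have k0 : 0 < k by rewrite invr_gt0 mulr_gt0// opK_gt0.
have k1 : k <= 1.
  by rewrite invf_le1 ?mulr_gt0 ?opK_gt0// /opK; lra.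
pose L : R := (a / 100) ^- 2 + 2.
have L0 : 0 < L by rewrite addr_gt0// invr_gt0 exprn_gt0// divr_gt0.
pose kap : R := (a ^+ 2 / 16 / 32) ^+ 2.
have a2 : 0 < a ^+ 2 / 16 by rewrite divr_gt0// exprn_gt0.
have kap0 : 0 < kap by rewrite exprn_gt0// divr_gt0.
have kap1 : kap <= 1.
  have h0 : 0 <= a ^+ 2 / 16 / 32 by rewrite ltW// divr_gt0.
  have h1 : a ^+ 2 <= 1 by rewrite expr_le1// ltW.
  have {}h1 : a ^+ 2 / 16 / 32 <= 1 by lra.
  by rewrite /kap expr_le1.
pose C1 : R := 4 * 64 / (a ^+ 2 / 16).
have C10 : 0 < C1 by rewrite divr_gt0// mulr_gt0.
(* One summand for each size condition of [llr_upper]: if one of them fails, n <= C2 (d + t), and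
   the trivial bound n has the right order. *)
pose C2 : R := 1 + L + 64 / kap.
have C20 : 0 < 64 / kap by rewrite divr_gt0.
exists (k / 512 / 9), (C1 + C2); split; first by move: k0; lra.
split; first by rewrite /C2; lra.
move=> d n d0 dn disp T P X Y model delta delta0 delta2 q.
set t := ln (1 / delta).
have t0 : 0 <= t by exact: ln_inv_ge0.
have n0 : (0 < n)%N by exact: leq_trans d0 dn.
have np : 0 < n%:R :> R by rewrite ltr0n.
have d1 : 1 <= d%:R :> R by rewrite ler1n.
have dnR : d%:R <= n%:R :> R by rewrite ler_nat.
pose M := Num.min n%:R (d%:R + t).
pose S := [set v : R | ((1 - delta)%:E <= P [set w | (llr X Y w <= v)%R])%E].
have SM v : S v -> k / 512 / 9 * M <= v.
  (* In both cases M <= d + min (n, t). If 8 d <= min (n, t), then M is at most 9/8 of this minimum,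
     which is at least 8 as the tail bound requires; otherwise M <= 9 d, whence the 9 in the
     constant. *)
  move=> Sv; have [tm|tm] := leP (8 * d%:R) (Num.min n%:R t).
    have mn : Num.min n%:R t <= n%:R by rewrite ge_min lexx.
    have mt : Num.min n%:R t <= t by rewrite ge_min lexx orbT.
    have m8 : 8 <= Num.min n%:R t by lra.
    apply: le_trans (llr_lower_tail model d0 dn delta0 m8 mn mt Sv).
    rewrite -/k -!mulrA ler_pM2l//.
    have d0R : 0 <= d%:R :> R by [].
    have := min_addr_le n%:R t d0R; rewrite -/M.
    by move: M (Num.min _ _) tm => u v'; lra.
  apply: le_trans (llr_lower_dim model d0 dn delta2 Sv).
  rewrite -/k -!mulrA ler_pM2l//.
  have d0R : 0 <= d%:R :> R by [].
  have := min_addr_le n%:R t d0R; rewrite -/M.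
  by move: M (Num.min _ _) tm => u v'; lra.
have [v Sv vM] : exists2 v, S v & v <= (C1 + C2) * M.
  have M0 : 0 <= M by rewrite le_min (ltW np); lra.
  have [[H1 [H2 H3]]|H] := pselect (L * d%:R <= n%:R /\ t <= n%:R /\ 64 * (d%:R + t) <= kap * n%:R).
    exists (C1 * (d%:R + t)).
      exact: (llr_upper model d0 dn delta0 delta2 a0 a1 a10 H1 H2 H3).
    have -> : M = d%:R + t.
      (* Since kap <= 1, the third condition forces d + t <= n, which decides the minimum. *)
      have : kap * n%:R <= 1 * n%:R by rewrite ler_pM2r.
      by rewrite /M => h; apply/min_idPr; lra.
    by rewrite ler_wpM2r ?addr_ge0//; rewrite /C2; lra.
  exists n%:R.
    by rewrite /S/= llr_le_n lee_fin; lra.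
  apply: (@le_trans _ _ (C2 * M)); last by rewrite ler_wpM2r//; lra.
  have nC : n%:R <= C2 * n%:R by rewrite ler_peMl ?ltW// /C2; lra.
  rewrite /M minEle; case: ifP => _ //.
  have dt0 : 0 <= d%:R + t by lra.
  have L1 : L * d%:R <= L * (d%:R + t) by rewrite ler_pM2l//; lra.
  have L2 : 0 <= L * (d%:R + t) by rewrite mulr_ge0// ltW.
  have K1 : 0 <= 64 / kap * (d%:R + t) by rewrite mulr_ge0// ltW.
  rewrite /C2 (mulrDl _ (64 / kap)) (mulrDl 1 L) mul1r.
  have [h1|h1] := leP (L * d%:R) n%:R; last by lra.
  have [h2|h2] := leP t n%:R; last by lra.
  have [h3|h3] := leP (64 * (d%:R + t)) (kap * n%:R); first by exfalso; apply: H.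
  have : n%:R <= 64 / kap * (d%:R + t).
    by rewrite mulrAC ler_pdivlMr// mulrC ltW.
  lra.
(* [Sv] makes the set nonempty and [SM] bounds it from below, so the real-valued [inf] is a true
   infimum. *)
split.
  by apply: lb_le_inf; [exists v|exact: SM].
apply: le_trans vM; apply: ge_inf => //.
by exists (k / 512 / 9 * M) => u; exact: SM.
Qed.
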